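(* Let $\gamma_1,\gamma_2,\delta_1,\delta_2,\delta_3,x,y,\rho\in\mathbb{C}$ with $\operatorname{Re}\rho>0$, let $\alpha_1,\alpha_2,\alpha_3,\beta_1,\beta_2,\beta_3$ be positive real numbers, let $\mu_1>0$, $\mu_2>0$ be real, and let $\operatorname{Re}p>0$. Then $$L_1\left\{t^{\rho-1}E_1\left(\begin{matrix}\gamma_1,\alpha_1;\gamma_2,\beta_1;\\ \delta_1,\alpha_2,\beta_2;\delta_2,\alpha_3;\delta_3,\beta_3;\end{matrix}\left|\begin{matrix}xt^{\mu_1}\\ yt^{\mu_2}\end{matrix}\right.\right);p\right\}=\frac{\Gamma(\rho)}{p^{\rho}}D_1\left(\begin{matrix}\rho,\mu_1,\mu_2;\gamma_1,\alpha_1;\gamma_2,\beta_1;\\ \delta_1,\alpha_2,\beta_2;\delta_2,\alpha_3;\delta_3,\beta_3;\end{matrix}\left|\begin{matrix}x/p^{\mu_1}\\ y/p^{\mu_2}\end{matrix}\right.\right).$$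
   Context: $L_1\{f(t);p\}=\int_0^\infty f(t)e^{-pt}\,dt$ is the one-dimensional Laplace transform. $(\gamma)_\lambda=\Gamma(\gamma+\lambda)/\Gamma(\gamma)$ for $\gamma\in\mathbb{C}$ and real $\lambda\ge0$. For complex $\gamma_i,\delta_i,x,y$ and positive real $\alpha_i,\beta_i$, $$D_1\left(\begin{matrix}\gamma_1,\alpha_1,\beta_1;\gamma_2,\alpha_2;\gamma_3,\beta_2;\\ \delta_1,\alpha_3,\beta_3;\delta_2,\alpha_4;\delta_3,\beta_4;\end{matrix}\left|\begin{matrix}x\\ y\end{matrix}\right.\right)=\sum_{m,n=0}^{\infty}\frac{(\gamma_1)_{\alpha_1 m+\beta_1 n}(\gamma_2)_{\alpha_2 m}(\gamma_3)_{\beta_2 n}}{\Gamma(\delta_1+\alpha_3 m+\beta_3 n)}\frac{x^m}{\Gamma(\delta_2+\alpha_4 m)}\frac{y^n}{\Gamma(\delta_3+\beta_4 n)},$$ $$E_1\left(\begin{matrix}\gamma_1,\alpha_1;\gamma_2,\beta_1;\\ \delta_1,\alpha_2,\beta_2;\delta_2,\alpha_3;\delta_3,\beta_3;\end{matrix}\left|\begin{matrix}x\\ y\end{matrix}\right.\right)=\sum_{m,n=0}^{\infty}\frac{(\gamma_1)_{\alpha_1 m}(\gamma_2)_{\beta_1 n}}{\Gamma(\delta_1+\alpha_2 m+\beta_2 n)}\frac{x^m}{\Gamma(\delta_2+\alpha_3 m)}\frac{y^n}{\Gamma(\delta_3+\beta_3 n)}.$$ The functions are considered at arguments in the region of absolute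 convergence of their defining series; powers of $p$ are principal.
   Formalization: The Laplace integral is assumed to exist (as an improper, possibly conditionally convergent integral); without this the left side can diverge although both series converge absolutely, e.g. E_1 = exp(xt) with x = 3/2, p = 1+2i. *)

(* Defs.v *)
From HB Require Import structures.
From mathcomp Require Import all_boot all_order all_algebra.
From mathcomp Require Import all_classical all_reals all_analysis.
From mathcomp Require Import complex.

Set Implicit Arguments.
Unset Strict Implicit.
Unset Printing Implicit Defensive.

Import Order.TTheory GRing.Theory Num.Theory.
Import numFieldNormedType.Exports.

Local Open Scope classical_set_scope.
Local Open Scope ring_scope.
Local Open Scope complex_scope.

Definition cmod (R : realType) (z : R[i]) : R := Normc.normc z.

Definition cexp (R : realType) (z : R[i]) : R[i] :=
  (expR (complex.Re z))%:C * (cos (complex.Im z) +i* sin (complex.Im z)).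

(* Principal argument, in ]-pi, pi] for z <> 0. *)
Definition carg (R : realType) (z : R[i]) : R :=
  if 0 <= complex.Im z then acos (complex.Re z / cmod z)
  else - acos (complex.Re z / cmod z).

Definition clog (R : realType) (z : R[i]) : R[i] := ln (cmod z) +i* carg z.

(* Principal power; the value at z = 0 follows the convention of powR. *)
Definition cpow (R : realType) (z w : R[i]) : R[i] :=
  if z == 0 then (w == 0)%:R else cexp (w * clog z).

Definition cintegral (R : realType) (A : set R) (f : R -> R[i]) : R[i] :=
  Rintegral (@lebesgue_measure R) A (fun t => complex.Re (f t)) +i*
  Rintegral (@lebesgue_measure R) A (fun t => complex.Im (f t)).

Definition cintegrable (R : realType) (A : set R) (f : R -> R[i]) : Prop :=
  (@lebesgue_measure R).-integrable A (fun t => (complex.Re (f t))%:E) /\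
  (@lebesgue_measure R).-integrable A (fun t => (complex.Im (f t))%:E).

Definition Gamma_integral (R : realType) (z : R[i]) : R[i] :=
  cintegral `]0, +oo[ (fun t : R => cpow t%:C (z - 1) * (expR (- t))%:C).

(* Euler's integral for Re z > 0, continued by Gamma (z + 1) = z * Gamma z; in
   the second branch n is the least natural number with Re (z + n) > 0.  At the
   poles 0, -1, -2, ... one factor of the product vanishes, so Gamma z = 0
   there, and u / Gamma z = 0 agrees with the entire function 1 / Gamma. *)
Definition Gamma (R : realType) (z : R[i]) : R[i] :=
  if 0 < complex.Re z then Gamma_integral z
  else let n := (Num.truncn (- complex.Re z)).+1 in
       Gamma_integral (z + n%:R) / \prod_(i < n) (z + i%:R).

(* (g)_l = Gamma (g + l) / Gamma g for real l >= 0.  The first case is the one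
   where g and g + l are both poles of Gamma: the quotient is then given its
   limit value, the rising factorial; in particular (g)_0 = 1 for every g. *)
Definition poch (R : realType) (g : R[i]) (l : R) : R[i] :=
  let n := Num.truncn l in
  if `[< exists k : nat, g = - k%:R >] && (l == n%:R)
  then \prod_(i < n) (g + i%:R)
  else Gamma (g + l%:C) / Gamma g.

Definition abs_summable2 (R : realType) (a : nat -> nat -> R[i]) : Prop :=
  summable [set: nat * nat] (fun k => (cmod (a k.1 k.2))%:E).

Definition rsum2 (R : realType) (a : nat -> nat -> R) : R :=
  limn (series (fun m => limn (series (a m)))).

(* Iterated sum; independent of the order of summation when abs_summable2 a. *)
Definition csum2 (R : realType) (a : nat -> nat -> R[i]) : R[i] :=
  rsum2 (fun m n => complex.Re (a m n)) +i*
  rsum2 (fun m n => complex.Im (a m n)).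

Definition D1_term (R : realType)
    (g1 : R[i]) (a1 b1 : R) (g2 : R[i]) (a2 : R) (g3 : R[i]) (b2 : R)
    (d1 : R[i]) (a3 b3 : R) (d2 : R[i]) (a4 : R) (d3 : R[i]) (b4 : R)
    (x y : R[i]) (m n : nat) : R[i] :=
  poch g1 (a1 * m%:R + b1 * n%:R) * poch g2 (a2 * m%:R) * poch g3 (b2 * n%:R)
    / Gamma (d1 + (a3 * m%:R + b3 * n%:R)%:C)
  * (x ^+ m / Gamma (d2 + (a4 * m%:R)%:C))
  * (y ^+ n / Gamma (d3 + (b4 * n%:R)%:C)).

Definition D1 (R : realType)
    (g1 : R[i]) (a1 b1 : R) (g2 : R[i]) (a2 : R) (g3 : R[i]) (b2 : R)
    (d1 : R[i]) (a3 b3 : R) (d2 : R[i]) (a4 : R) (d3 : R[i]) (b4 : R)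
    (x y : R[i]) : R[i] :=
  csum2 (D1_term g1 a1 b1 g2 a2 g3 b2 d1 a3 b3 d2 a4 d3 b4 x y).

Definition E1_term (R : realType)
    (g1 : R[i]) (a1 : R) (g2 : R[i]) (b1 : R)
    (d1 : R[i]) (a2 b2 : R) (d2 : R[i]) (a3 : R) (d3 : R[i]) (b3 : R)
    (x y : R[i]) (m n : nat) : R[i] :=
  poch g1 (a1 * m%:R) * poch g2 (b1 * n%:R)
    / Gamma (d1 + (a2 * m%:R + b2 * n%:R)%:C)
  * (x ^+ m / Gamma (d2 + (a3 * m%:R)%:C))
  * (y ^+ n / Gamma (d3 + (b3 * n%:R)%:C)).

Definition E1 (R : realType)
    (g1 : R[i]) (a1 : R) (g2 : R[i]) (b1 : R)
    (d1 : R[i]) (a2 b2 : R) (d2 : R[i]) (a3 : R) (d3 : R[i]) (b3 : R)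
    (x y : R[i]) : R[i] :=
  csum2 (E1_term g1 a1 g2 b1 d1 a2 b2 d2 a3 d3 b3 x y).

Definition laplace_kernel (R : realType) (f : R -> R[i]) (p : R[i]) (t : R) :
  R[i] := f t * cexp (- (p * t%:C)).

(* The integral over the half-line is improper at infinity: conditional
   convergence is allowed. *)
Definition laplace_exists (R : realType) (f : R -> R[i]) (p : R[i]) : Prop :=
  [/\ forall T : R, 0 < T -> cintegrable `]0, T] (laplace_kernel f p),
      cvg (complex.Re (cintegral `]0, T] (laplace_kernel f p)) @[T --> +oo%R])
    & cvg (complex.Im (cintegral `]0, T] (laplace_kernel f p)) @[T --> +oo%R])].

Definition laplace (R : realType) (f : R -> R[i]) (p : R[i]) : R[i] :=
  lim (complex.Re (cintegral `]0, T] (laplace_kernel f p)) @[T --> +oo%R]) +i*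
  lim (complex.Im (cintegral `]0, T] (laplace_kernel f p)) @[T --> +oo%R]).

(* Main.v *)
Require Import Defs.
From HB Require Import structures.
From mathcomp Require Import all_boot all_order all_algebra.
From mathcomp Require Import all_classical all_reals all_analysis.
From mathcomp Require Import complex.
From mathcomp Require Import ring lra measurable_realfun.

Import Order.TTheory GRing.Theory Num.Theory.
Import numFieldNormedType.Exports.

Local Open Scope classical_set_scope.
Local Open Scope ring_scope.
Local Open Scope complex_scope.

(** The summability of the D1 series is a statement at |p|, whereas integrating the
    E1 series term by term against exp (- p t) would require it at Re p, which may
    be smaller; accordingly, the Laplace integral may converge only conditionally.
    The integrand is therefore first multiplied by [reg], that is by
    exp (- eps t^kap) with kap > 1 close to 1, and eps is then sent to 0.

    For fixed eps this factor decays faster than exp (- |p| t), so that sum and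
    integral commute ([regularised_swap]). Each term is then the integral of
    t^(z-1) exp (- p t - eps t^kap). Moving the contour from the positive axis to
    the ray through 1 / p ([rotation]) turns it into p^(-z) times the integral of
    u^(z-1) exp (- u) exp (- eps (u / p)^kap), and the last factor has modulus at
    most 1 as long as kap |arg p| <= pi / 2. Hence these integrals are bounded by
    2 |p^(-z)| Gamma (Re z), uniformly in eps, and tend to p^(-z) Gamma z
    ([cintegral_tkern_bound], [cintegral_tkern_cvg]). Since |Gamma z| is at least a
    constant times Gamma (Re z) on a horizontal half-line ([Gamma_lower]), the
    majorants are summable by hypothesis, and the sum of the terms tends to the D1
    series by dominated convergence ([ctannery]). On the other side, the
    regularised integrals tend to the improper Laplace integral by an Abelian
    theorem ([abel]). Both limits agree ([laplace_series]). *)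

Set Implicit Arguments.
Unset Strict Implicit.
Unset Printing Implicit Defensive.

(** * Complex arithmetic, exponential and principal logarithm *)
Section ComplexBasics.
Context {R : realType}.
Implicit Types z w : R[i].

Lemma complex_ext z w :
  complex.Re z = complex.Re w -> complex.Im z = complex.Im w -> z = w.
Proof. by case: z w => [a b] [c d] /= -> ->. Qed.

Lemma cReD z w : complex.Re (z + w) = complex.Re z + complex.Re w.
Proof. by case: z w => [a b] [c d]. Qed.

Lemma cImD z w : complex.Im (z + w) = complex.Im z + complex.Im w.
Proof. by case: z w => [a b] [c d]. Qed.

Lemma cReN z : complex.Re (- z) = - complex.Re z.
Proof. by case: z. Qed.

Lemma cImN z : complex.Im (- z) = - complex.Im z.
Proof. by case: z. Qed.

Lemma cReM z w : complex.Re (z * w) =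
  complex.Re z * complex.Re w - complex.Im z * complex.Im w.
Proof. by case: z w => [a b] [c d]. Qed.

Lemma cImM z w : complex.Im (z * w) =
  complex.Re z * complex.Im w + complex.Im z * complex.Re w.
Proof. by case: z w => [a b] [c d]. Qed.

Lemma cRe_realM (a : R) z : complex.Re (a%:C * z) = a * complex.Re z.
Proof. by rewrite cReM /= mul0r subr0. Qed.

Lemma cIm_realM (a : R) z : complex.Im (a%:C * z) = a * complex.Im z.
Proof. by rewrite cImM /= mul0r addr0. Qed.

Definition cReImE := (cReD, cImD, cReN, cImN, cReM, cImM).

Lemma cRe_sum n (u : nat -> R[i]) :
  complex.Re (\sum_(k < n) u k) = \sum_(k < n) complex.Re (u k).
Proof. by elim: n => [|n ih]; rewrite ?big_ord0// !big_ord_recr cReD ih. Qed.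

Lemma cIm_sum n (u : nat -> R[i]) :
  complex.Im (\sum_(k < n) u k) = \sum_(k < n) complex.Im (u k).
Proof. by elim: n => [|n ih]; rewrite ?big_ord0// !big_ord_recr cImD ih. Qed.

Lemma cmodE z : cmod z = Num.sqrt (complex.Re z ^+ 2 + complex.Im z ^+ 2).
Proof. by case: z. Qed.

Lemma cmod_ge0 z : 0 <= cmod z.
Proof. by rewrite cmodE sqrtr_ge0. Qed.

Lemma cmodM z w : cmod (z * w) = cmod z * cmod w.
Proof. exact: Normc.normcM. Qed.

Lemma cmodN z : cmod (- z) = cmod z.
Proof. by rewrite !cmodE !cReImE !sqrrN. Qed.

Lemma cmodD z w : cmod (z + w) <= cmod z + cmod w.
Proof. exact: le_normcD. Qed.

Lemma cmod_real (x : R) : cmod x%:C = `|x|.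
Proof. by rewrite cmodE /= expr0n addr0 sqrtr_sqr. Qed.

Lemma cmod_eq0 z : cmod z = 0 -> z = 0.
Proof. exact: Normc.eq0_normc. Qed.

Lemma cmod_gt0 z : (0 < cmod z) = (z != 0).
Proof.
rewrite lt_neqAle cmod_ge0 andbT eq_sym; congr (~~ _).
by apply/eqP/eqP => [/cmod_eq0//|->]; rewrite /cmod Normc.normc0.
Qed.

Lemma Re_le_cmod z : `|complex.Re z| <= cmod z.
Proof. by rewrite cmodE -sqrtr_sqr ler_wsqrtr// lerDl sqr_ge0. Qed.

Lemma Im_le_cmod z : `|complex.Im z| <= cmod z.
Proof. by rewrite cmodE -sqrtr_sqr ler_wsqrtr// lerDr sqr_ge0. Qed.

Lemma cmod_le_ReIm z : cmod z <= `|complex.Re z| + `|complex.Im z|.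
Proof.
rewrite cmodE -[leRHS]ger0_norm ?addr_ge0// -sqrtr_sqr ler_wsqrtr//.
rewrite sqrrD !real_normK ?num_real//.
have := mulr_ge0 (normr_ge0 (complex.Re z)) (normr_ge0 (complex.Im z)).
by lra.
Qed.

Lemma cexpD z w : cexp (z + w) = cexp z * cexp w.
Proof.
case: z w => [a b] [c d]; rewrite /cexp /= expRD cosD sinD.
by apply: complex_ext; rewrite !cReImE /=; ring.
Qed.

Lemma cexp0 : cexp (0 : R[i]) = 1.
Proof. by apply: complex_ext; rewrite /cexp !cReImE /= expR0 cos0 sin0; ring. Qed.

Lemma Re_cexp z :
  complex.Re (cexp z) = expR (complex.Re z) * cos (complex.Im z).
Proof. by rewrite /cexp cReM /= mul0r subr0. Qed.

Lemma Im_cexp z :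
  complex.Im (cexp z) = expR (complex.Re z) * sin (complex.Im z).
Proof. by rewrite /cexp cImM /= mul0r addr0. Qed.

Lemma cmod_cexp z : cmod (cexp z) = expR (complex.Re z).
Proof.
rewrite cmodE Re_cexp Im_cexp !exprMn -mulrDr cos2Dsin2 mulr1 sqrtr_sqr.
by rewrite ger0_norm// expR_ge0.
Qed.

Lemma cexp_neq0 z : cexp z != 0.
Proof. by rewrite -cmod_gt0 cmod_cexp expR_gt0. Qed.

Lemma cexpN z : cexp (- z) = (cexp z)^-1.
Proof.
by apply: (mulfI (cexp_neq0 z)); rewrite -cexpD subrr cexp0 divff ?cexp_neq0.
Qed.

Lemma cexp_nat z n : cexp (n%:R * z) = cexp z ^+ n.
Proof.
elim: n => [|n ih]; first by rewrite mul0r cexp0.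
by rewrite exprS -ih -cexpD -natr1 mulrDl mul1r addrC.
Qed.

Lemma cexp_real (x : R) : cexp x%:C = (expR x)%:C.
Proof.
by apply: complex_ext; rewrite ?Re_cexp ?Im_cexp /= ?cos0 ?sin0 ?mulr1 ?mulr0.
Qed.

Lemma clog_pos (t : R) : 0 < t -> clog t%:C = (ln t)%:C.
Proof.
move=> t0; have nt : `|t| = t by rewrite gtr0_norm.
rewrite /clog /carg cmod_real nt /= lexx divff ?gt_eqF// acos1.
by apply: complex_ext.
Qed.

Lemma cpow_pos (t : R) z : 0 < t -> cpow t%:C z = cexp (z * (ln t)%:C).
Proof.
move=> t0; rewrite /cpow clog_pos// ifF//; apply/negP => /eqP[t00].
by rewrite t00 ltxx in t0.
Qed.

Lemma cexp_ln (t : R) : 0 < t -> cexp (ln t)%:C = t%:C.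
Proof. by move=> t0; rewrite cexp_real lnK. Qed.

Lemma cexp_lnV (t : R) : 0 < t -> (t^-1)%:C = cexp (- (ln t)%:C).
Proof. by move=> t0; rewrite -rmorphN cexp_real expRN lnK. Qed.

Section RightHalfPlane.
Variable p : R[i].
Hypothesis hp : 0 < complex.Re p.

Lemma right_cmod_gt0 : 0 < cmod p.
Proof. by apply: lt_le_trans (Re_le_cmod p); rewrite gtr0_norm. Qed.

Lemma cexp_clog : cexp (clog p) = p.
Proof.
have c0 := right_cmod_gt0; set c := cmod p in c0 *.
have cc : c ^+ 2 = complex.Re p ^+ 2 + complex.Im p ^+ 2.
  by rewrite /c cmodE sqr_sqrtr// addr_ge0// sqr_ge0.
have cE : c = cmod p by [].
have n0 : c != 0 by rewrite gt_eqF.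
have hq : -1 <= complex.Re p / c <= 1.
  have := Re_le_cmod p; rewrite -/c ler_norml => /andP[h1 h2].
  by rewrite ler_pdivlMr// ler_pdivrMr// mulN1r mul1r h1 h2.
have cs : cos (acos (complex.Re p / c)) = complex.Re p / c by rewrite acosK.
have sn : sin (acos (complex.Re p / c)) = `|complex.Im p| / c.
  rewrite sin_acos//.
  have -> : 1 - (complex.Re p / c) ^+ 2 = (complex.Im p / c) ^+ 2.
    by rewrite !exprMn exprVn cc; field; rewrite -cc sqrf_eq0.
  by rewrite sqrtr_sqr normrM normfV (gtr0_norm c0).
apply: complex_ext; rewrite ?Re_cexp ?Im_cexp /clog /carg /= -/c lnK//;
  case: leP => hi; rewrite ?cosN ?sinN ?cs ?sn.
- by field.
- by field.
- by rewrite ger0_norm//; field.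
- by rewrite ltr0_norm//; field.
Qed.

(** The cosine of this argument is Re p / |p|, which is positive. *)
Lemma norm_carg_lt : `|carg p| < pi / 2.
Proof.
have c0 := right_cmod_gt0; set c := cmod p in c0.
have hq : -1 <= complex.Re p / c <= 1.
  have := Re_le_cmod p; rewrite -/c ler_norml => /andP[h1 h2].
  by rewrite ler_pdivlMr// ler_pdivrMr// mulN1r mul1r h1 h2.
have [/andP[a0 api] ca] := acos_def hq.
have -> : `|carg p| = acos (complex.Re p / c).
  by rewrite /carg -/c; case: ifP => _; rewrite ?normrN ger0_norm.
rewrite ltNge; apply/negP => hge.
have : cos (acos (complex.Re p / c)) <= 0.
  have := @cos_ge0_pihalf R (pi - acos (complex.Re p / c)).
  rewrite cosB cospi sinpi mul0r addr0 mulN1r oppr_ge0; apply.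
  by apply/andP; split; lra.
by rewrite ca leNgt divr_gt0.
Qed.

Lemma cpow_right z : cpow p z = cexp (z * clog p).
Proof. by rewrite /cpow ifF//; apply/negP => /eqP p0; move: hp; rewrite p0 ltxx. Qed.

End RightHalfPlane.

Lemma cmod_sum n (u : nat -> R[i]) :
  cmod (\sum_(k < n) u k) <= \sum_(k < n) cmod (u k).
Proof.
elim: n => [|n ih]; first by rewrite !big_ord0 /cmod Normc.normc0.
by rewrite !big_ord_recr/= (le_trans (cmodD _ _))// lerD2r.
Qed.

End ComplexBasics.

(** * Calculus of complex-valued functions of a real variable *)
Section ComplexCalculus.
Context {R : realType}.
Implicit Types (z w : R[i]) (f g : R -> R[i]).

(** Componentwise, because it is fed to theorems about real-valued functions. *)
Definition is_cderive f (x : R) (d : R[i]) : Prop :=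
  is_derive x (1 : R) (fun t => complex.Re (f t)) (complex.Re d) /\
  is_derive x (1 : R) (fun t => complex.Im (f t)) (complex.Im d).

Lemma is_cderive_cst c x : is_cderive (fun=> c) x 0.
Proof. by split; exact: is_derive_cst. Qed.

Lemma is_cderive_real (h : R -> R) (x d : R) :
  is_derive x (1 : R) h d -> is_cderive (fun t => (h t)%:C) x d%:C.
Proof. by move=> hd; split => //=; exact: is_derive_cst. Qed.

Lemma is_cderiveD f g x df dg : is_cderive f x df -> is_cderive g x dg ->
  is_cderive (fun t => f t + g t) x (df + dg).
Proof.
move=> [f1 f2] [g1 g2]; split.
- by rewrite cReD; under eq_fun do rewrite cReD; exact: (is_deriveD f1 g1).
- by rewrite cImD; under eq_fun do rewrite cImD; exact: (is_deriveD f2 g2).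
Qed.

Lemma is_cderiveM f g x df dg : is_cderive f x df -> is_cderive g x dg ->
  is_cderive (fun t => f t * g t) x (df * g x + f x * dg).
Proof.
move=> [f1 f2] [g1 g2]; split.
- under eq_fun do rewrite cReM.
  apply: (is_derive_eq (is_deriveB (is_deriveM f1 g1) (is_deriveM f2 g2))).
  by rewrite !cReImE /GRing.scale /=; ring.
- under eq_fun do rewrite cImM.
  apply: (is_derive_eq (is_deriveD (is_deriveM f1 g2) (is_deriveM f2 g1))).
  by rewrite !cReImE /GRing.scale /=; ring.
Qed.

Lemma is_cderiveZ c f x df : is_cderive f x df ->
  is_cderive (fun t => c * f t) x (c * df).
Proof.
by move=> h; have := is_cderiveM (is_cderive_cst c x) h; rewrite mul0r add0r.
Qed.

Lemma is_cderive_cexp f x df : is_cderive f x df ->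
  is_cderive (fun t => cexp (f t)) x (df * cexp (f x)).
Proof.
move=> [f1 f2].
have he : is_derive x (1 : R) (fun t => expR (complex.Re (f t)))
    (complex.Re df * expR (complex.Re (f x))).
  apply: (is_derive_eq (@is_derive1_comp _ expR _ _ _ _ (is_derive_expR _) f1)).
  by rewrite mulrC.
have hc : is_derive x (1 : R) (fun t => cos (complex.Im (f t)))
    (- complex.Im df * sin (complex.Im (f x))).
  apply: (is_derive_eq (@is_derive1_comp _ cos _ _ _ _ (is_derive_cos _) f2)).
  by ring.
have hs : is_derive x (1 : R) (fun t => sin (complex.Im (f t)))
    (complex.Im df * cos (complex.Im (f x))).
  apply: (is_derive_eq (@is_derive1_comp _ sin _ _ _ _ (is_derive_sin _) f2)).
  by rewrite mulrC.
split.
- under eq_fun do rewrite Re_cexp.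
  apply: (is_derive_eq (is_deriveM he hc)).
  by rewrite cReM Re_cexp Im_cexp /GRing.scale /=; ring.
- under eq_fun do rewrite Im_cexp.
  apply: (is_derive_eq (is_deriveM he hs)).
  by rewrite cImM Re_cexp Im_cexp /GRing.scale /=; ring.
Qed.

Lemma is_cderive_eq f x d d' : is_cderive f x d -> d = d' -> is_cderive f x d'.
Proof. by move=> ? <-. Qed.

Lemma is_cderive_continuous f x d : is_cderive f x d ->
  {for x, continuous (fun t => complex.Re (f t))} /\
  {for x, continuous (fun t => complex.Im (f t))}.
Proof.
by move=> [[f1 _] [f2 _]]; split; apply: differentiable_continuous;
  exact/derivable1_diffP.
Qed.

Lemma is_cderive_inv_real (u : R) : 0 < u ->
  exists d, is_cderive (fun t : R => (t^-1)%:C) u d.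
Proof.
move=> u0; eexists; apply: is_cderive_real.
have u1 : u != 0 by rewrite gt_eqF.
exact: (is_deriveV u1 (is_derive_id u (1 : R))).
Qed.

End ComplexCalculus.

(** * Integration of complex-valued functions *)
Section ComplexIntegral.
Context {R : realType}.
Implicit Types (z w c : R[i]) (f g : R -> R[i]) (A : set R).
Local Notation mu := (@lebesgue_measure R).

Definition cmeasurable A f : Prop :=
  measurable_fun A (fun t => complex.Re (f t)) /\
  measurable_fun A (fun t => complex.Im (f t)).

Lemma cmeasurable_cderivable f :
  (forall x, 0 < x -> exists d, is_cderive f x d) ->
  cmeasurable `]0, +oo[ f.
Proof.
move=> h; split; apply: open_continuous_measurable_fun;
  try exact: interval_open; move=> x; rewrite inE/= in_itv/= andbT => x0;
  by have [d /is_cderive_continuous[]] := h _ x0.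
Qed.

Lemma cintegrable_dominated A f (g : R -> R) : measurable A ->
  cmeasurable A f -> (forall t, A t -> cmod (f t) <= g t) ->
  mu.-integrable A (EFin \o g) -> cintegrable A f.
Proof.
move=> mA [f1 f2] fg ig; split.
- apply: le_integrable ig => //; first exact/measurable_EFinP.
  move=> t At; rewrite lee_fin (le_trans (Re_le_cmod _))//.
  by rewrite (le_trans (fg _ At))// ler_norm.
- apply: le_integrable ig => //; first exact/measurable_EFinP.
  move=> t At; rewrite lee_fin (le_trans (Im_le_cmod _))//.
  by rewrite (le_trans (fg _ At))// ler_norm.
Qed.

Lemma cintegrable_cmeasurable A f : cintegrable A f -> cmeasurable A f.
Proof.
by move=> [/integrableP[/measurable_EFinP f1 _] /integrableP[/measurable_EFinP f2 _]].
Qed.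

Lemma eq_cintegral A f g : (forall t, A t -> f t = g t) ->
  cintegral A f = cintegral A g.
Proof.
by move=> fg; rewrite /cintegral; congr (_ +i* _); apply: eq_Rintegral => t;
  rewrite inE => /fg ->.
Qed.

Lemma eq_cintegrable A f g : measurable A -> (forall t, A t -> f t = g t) ->
  cintegrable A f -> cintegrable A g.
Proof.
move=> mA fg [f1 f2]; split.
- by apply: eq_integrable f1 => // t; rewrite inE => /fg ->.
- by apply: eq_integrable f2 => // t; rewrite inE => /fg ->.
Qed.

Lemma cintegrableZ A c f : measurable A -> cintegrable A f ->
  cintegrable A (fun t => c * f t).
Proof.
move=> mA [f1 f2]; split.
- under eq_fun do rewrite cReM EFinB 2!EFinM.
  by apply: integrableB => //; exact: integrableZl.
- under eq_fun do rewrite cImM EFinD 2!EFinM.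
  by apply: integrableD => //; exact: integrableZl.
Qed.

Lemma cintegralZ A c f : measurable A -> cintegrable A f ->
  cintegral A (fun t => c * f t) = c * cintegral A f.
Proof.
move=> mA [f1 f2].
have f1Z a : mu.-integrable A (EFin \o (fun t => a * complex.Re (f t))).
  by apply: (integrableZl _ a f1).
have f2Z a : mu.-integrable A (EFin \o (fun t => a * complex.Im (f t))).
  by apply: (integrableZl _ a f2).
rewrite /cintegral; apply: complex_ext; rewrite !cReImE /=.
- under eq_fun do rewrite cReM.
  by rewrite RintegralB// !RintegralZl.
- under eq_fun do rewrite cImM.
  by rewrite RintegralD// !RintegralZl.
Qed.

Lemma cintegrable0 A : cintegrable A (fun=> 0 : R[i]).
Proof. by split; exact: integrable0. Qed.

Lemma cintegrableD A f g : measurable A -> cintegrable A f -> cintegrable A g ->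
  cintegrable A (fun t => f t + g t).
Proof.
move=> mA [f1 f2] [g1 g2]; split.
- by under eq_fun do rewrite cReD EFinD; exact: integrableD.
- by under eq_fun do rewrite cImD EFinD; exact: integrableD.
Qed.

Lemma cintegralD A f g : measurable A -> cintegrable A f -> cintegrable A g ->
  cintegral A (fun t => f t + g t) = cintegral A f + cintegral A g.
Proof.
move=> mA [f1 f2] [g1 g2]; rewrite /cintegral.
apply: complex_ext; rewrite !cReImE /=.
- by under eq_fun do rewrite cReD; rewrite RintegralD.
- by under eq_fun do rewrite cImD; rewrite RintegralD.
Qed.

Lemma cintegrable_sum A (u : nat -> R -> R[i]) n : measurable A ->
  (forall k, cintegrable A (u k)) ->
  cintegrable A (fun t => \sum_(k < n) u k t).
Proof.
move=> mA iu; elim: n => [|n ih].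
  by under eq_fun do rewrite big_ord0; exact: cintegrable0.
by under eq_fun do rewrite big_ord_recr; exact: cintegrableD.
Qed.

Lemma cintegral_sum A (u : nat -> R -> R[i]) n : measurable A ->
  (forall k, cintegrable A (u k)) ->
  cintegral A (fun t => \sum_(k < n) u k t) = \sum_(k < n) cintegral A (u k).
Proof.
move=> mA iu; elim: n => [|n ih].
  under eq_fun do rewrite big_ord0.
  by rewrite big_ord0 /cintegral /= /Rintegral !integral0.
under eq_fun do rewrite big_ord_recr.
by rewrite cintegralD ?ih ?big_ord_recr//; exact: cintegrable_sum.
Qed.

(** The factor 2 comes from bounding the two components separately: an absolute
    constant is harmless below. *)
Lemma cmod_cintegral_le A f (g : R -> R) : measurable A ->
  cintegrable A f -> (forall t, A t -> cmod (f t) <= g t) ->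
  mu.-integrable A (EFin \o g) ->
  cmod (cintegral A f) <= 2 * Rintegral mu A g.
Proof.
move=> mA [f1 f2] fg ig; rewrite (le_trans (cmod_le_ReIm _))//=.
rewrite mulrDl mul1r lerD//.
- rewrite (le_trans (le_normr_Rintegral _ _))// le_Rintegral//.
    exact: (integrable_norm f1).
  by move=> t At; rewrite (le_trans (Re_le_cmod _))// fg.
- rewrite (le_trans (le_normr_Rintegral _ _))// le_Rintegral//.
    exact: (integrable_norm f2).
  by move=> t At; rewrite (le_trans (Im_le_cmod _))// fg.
Qed.

(** Componentwise, to match the definition of the complex integral. *)
Definition ccvg (u : nat -> R[i]) (l : R[i]) : Prop :=
  (complex.Re (u n) @[n --> \oo] --> complex.Re l) /\
  (complex.Im (u n) @[n --> \oo] --> complex.Im l).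

Lemma ccvg_unique (u : nat -> R[i]) l l' : ccvg u l -> ccvg u l' -> l = l'.
Proof.
move=> [u1 u2] [v1 v2]; apply: complex_ext.
- exact: (cvg_unique _ u1 v1).
- exact: (cvg_unique _ u2 v2).
Qed.

Lemma ccvg_cst l : ccvg (fun=> l) l.
Proof. by split; exact: cvg_cst. Qed.

Lemma ccvgM (u v : nat -> R[i]) l l' : ccvg u l -> ccvg v l' ->
  ccvg (fun n => u n * v n) (l * l').
Proof.
move=> [u1 u2] [v1 v2]; split; rewrite !cReImE.
- by under eq_fun do rewrite cReM; apply: cvgB; exact: cvgM.
- by under eq_fun do rewrite cImM; apply: cvgD; exact: cvgM.
Qed.

Lemma ccvgZ c (u : nat -> R[i]) l : ccvg u l -> ccvg (fun n => c * u n) (c * l).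
Proof. exact/ccvgM/ccvg_cst. Qed.

Lemma ccvg_cexp (u : nat -> R[i]) l : ccvg u l ->
  ccvg (fun n => cexp (u n)) (cexp l).
Proof.
move=> [u1 u2]; split; rewrite ?Re_cexp ?Im_cexp.
- under eq_fun do rewrite Re_cexp.
  apply: cvgM; first exact: (cvg_comp _ _ u1 (@continuous_expR R _)).
  exact: (cvg_comp _ _ u2 (@continuous_cos R _)).
- under eq_fun do rewrite Im_cexp.
  apply: cvgM; first exact: (cvg_comp _ _ u1 (@continuous_expR R _)).
  exact: (cvg_comp _ _ u2 (@continuous_sin R _)).
Qed.

Lemma ccvg_real (u : nat -> R) (l : R) : u n @[n --> \oo] --> l ->
  ccvg (fun n => (u n)%:C) l%:C.
Proof. by move=> h; split => //=; exact: cvg_cst. Qed.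

Lemma Rintegral_dct A (u : nat -> R -> R) (f g : R -> R) : measurable A ->
  (forall n, measurable_fun A (u n)) ->
  (forall t, A t -> u n t @[n --> \oo] --> f t) ->
  mu.-integrable A (EFin \o g) ->
  (forall n t, A t -> `|u n t| <= g t) ->
  mu.-integrable A (EFin \o f) /\
  (Rintegral mu A (u n) @[n --> \oo] --> Rintegral mu A f).
Proof.
move=> mA mu_ uf ig ug.
have ufE t : A t -> (u n t)%:E @[n --> \oo] --> (f t)%:E.
  by move=> At; apply: cvg_EFin; [exact: nearW|exact: uf].
have mEu n : measurable_fun A (EFin \o u n) by exact/measurable_EFinP.
have mf : measurable_fun A (EFin \o f).
  exact: (emeasurable_fun_cvg (fun n => EFin \o u n)).
have [] := @dominated_convergence _ _ _ mu A mA (fun n => EFin \o u n) (EFin \o f) (EFin \o g).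
- exact: mEu.
- exact: mf.
- by apply: aeW => t At; exact: ufE.
- exact: ig.
- by apply: aeW => t n At; rewrite lee_fin ug.
move=> intf _ h; split => //.
apply: fine_cvg; rewrite fineK//.
exact: integrable_fin_num.
Qed.

Lemma cintegral_dct A (u : nat -> R -> R[i]) f (g : R -> R) : measurable A ->
  (forall n, cmeasurable A (u n)) ->
  (forall t, A t -> ccvg (u ^~ t) (f t)) ->
  mu.-integrable A (EFin \o g) ->
  (forall n t, A t -> cmod (u n t) <= g t) ->
  cintegrable A f /\ ccvg (fun n => cintegral A (u n)) (cintegral A f).
Proof.
move=> mA mu_ uf ig ug.
have [f1 c1] := @Rintegral_dct A (fun n t => complex.Re (u n t))
   (fun t => complex.Re (f t)) g mA (fun n => (mu_ n).1)
   (fun t At => (uf t At).1) ig (fun n t At => le_trans (Re_le_cmod _) (ug n t At)).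
have [f2 c2] := @Rintegral_dct A (fun n t => complex.Im (u n t))
   (fun t => complex.Im (f t)) g mA (fun n => (mu_ n).2)
   (fun t At => (uf t At).2) ig (fun n t At => le_trans (Im_le_cmod _) (ug n t At)).
by split; split.
Qed.

Lemma squeeze0 (f g : nat -> R) : (forall n, 0 <= f n <= g n) ->
  g n @[n --> \oo] --> (0 : R) -> f n @[n --> \oo] --> (0 : R).
Proof.
move=> fg g0; apply: (@squeeze_cvgr _ _ _ _ (cst 0) g f _ 0 _ g0).
  exact: nearW.
exact: cvg_cst.
Qed.

Lemma cvg0_le_cmod (f : nat -> R) (g : nat -> R[i]) :
  (forall n, `|f n| <= cmod (g n)) -> cmod (g n) @[n --> \oo] --> (0 : R) ->
  f n @[n --> \oo] --> (0 : R).
Proof.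
move=> fg g0; apply: norm_cvg0.
by apply: (squeeze0 _ g0) => n; rewrite normr_ge0 fg.
Qed.

End ComplexIntegral.

(** * Primitives and integrability on the open half-line *)
Section HalfLine.
Context {R : realType}.
Implicit Types (h H : R -> R).
Local Notation mu := (@lebesgue_measure R).
Local Notation Rpos := (`]0, +oo[%classic : set R).

Lemma RposP (x : R) : Rpos x -> 0 < x.
Proof. by rewrite /= in_itv/= andbT. Qed.

(** Compact intervals that increase to the open half-line, with a nonempty
    interior for every n. *)
Definition exhaust (n : nat) : set R := `[n.+1%:R^-1, n.+2%:R].

Lemma measurable_Rpos : measurable Rpos.
Proof. exact: measurable_itv. Qed.

Lemma exhaust_bounds n : (0 : R) < (n.+1%:R : R)^-1 < (n.+2%:R : R).
Proof.
rewrite invr_gt0 ltr0Sn/= (@le_lt_trans _ _ 1)// ?ltr1n//.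
by rewrite invf_le1 ?ltr0Sn// ler1n.
Qed.

Lemma exhaust_sub n : exhaust n `<=` Rpos.
Proof.
move=> x /=; rewrite /exhaust/= !in_itv/= andbT => /andP[+ _].
by apply: lt_le_trans; have /andP[] := exhaust_bounds n.
Qed.

Lemma exhaust_near (x : R) : 0 < x -> \forall n \near \oo, exhaust n x.
Proof.
move=> x0; near=> n.
have hx : x^-1 + x < n.+1%:R.
  near: n; exists (Num.truncn (x^-1 + x)) => // n /= hn.
  by rewrite (lt_le_trans (truncnS_gt _))// ler_nat ltnS.
have xi : 0 < x^-1 by rewrite invr_gt0.
rewrite /exhaust /= in_itv/=; apply/andP; split.
  by rewrite -[leRHS]invrK lef_pV2 ?posrE// ltW//; lra.
by rewrite -[in leRHS]addn1 natrD; lra.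
Unshelve. all: by end_near. Qed.

Lemma bigcup_exhaust : \bigcup_n exhaust n = Rpos.
Proof.
apply/seteqP; split=> [x [n _ /exhaust_sub]//|x/=].
rewrite in_itv/= andbT => /exhaust_near[N _ /(_ N (leqnn N))] xN.
by exists N.
Qed.

Lemma FTC2_pos h H (x y : R) : 0 < x < y ->
  (forall u : R, 0 < u -> is_derive u (1 : R) H (h u)) ->
  (forall u : R, 0 < u -> {for u, continuous h}) ->
  (\int[mu]_(u in `[x, y]) (h u)%:E = (H y - H x)%:E)%E.
Proof.
move=> /andP[x0 xy] dH ch.
have y0 := lt_trans x0 xy.
have cH (u : R) : 0 < u -> {for u, continuous H}.
  move=> u0; have [d _] := dH _ u0.
  by apply: differentiable_continuous; exact/derivable1_diffP.
rewrite (@continuous_FTC2 _ h H)//.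
- apply: continuous_in_subspaceT => u; rewrite inE/= in_itv/= => /andP[xu _].
  exact/ch/(lt_le_trans x0 xu).
- split.
  + move=> u; rewrite in_itv/= => /andP[xu _].
    by have [] := dH _ (lt_trans x0 xu).
  + by apply: cvg_at_right_filter; exact: cH.
  + by apply: cvg_at_left_filter; exact: cH.
- move=> u; rewrite in_itv/= => /andP[xu _].
  by have [_ <-] := dH _ (lt_trans x0 xu); rewrite derive1E.
Qed.

Lemma measurable_continuous_pos h :
  (forall u : R, 0 < u -> {for u, continuous h}) -> measurable_fun Rpos h.
Proof.
move=> ch; apply: open_continuous_measurable_fun; first exact: interval_open.
by move=> u; rewrite inE/= in_itv/= andbT => /ch.
Qed.

(** By monotone convergence along [exhaust], the integral is a limit of
    increments of the primitive. *)
Lemma integrable_bounded_primitive h H (M : R) :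
  (forall u : R, 0 < u -> is_derive u (1 : R) H (h u)) ->
  (forall u : R, 0 < u -> {for u, continuous h}) ->
  (forall u : R, 0 < u -> 0 <= h u) ->
  (forall u : R, 0 < u -> `|H u| <= M) ->
  mu.-integrable Rpos (EFin \o h).
Proof.
move=> dH ch h0 HM.
have mh := measurable_continuous_pos ch.
apply/integrableP; split; first exact/measurable_EFinP.
have -> : (\int[mu]_(x in Rpos) `|(EFin \o h) x| =
  \int[mu]_(x in \bigcup_n exhaust n) (h x)%:E)%E.
  rewrite bigcup_exhaust; apply: eq_integral => u.
  by rewrite inE/= in_itv/= andbT => u0; rewrite ger0_norm// h0.
have cv : (\int[mu]_(x in exhaust n) (h x)%:E @[n --> \oo] -->
    \int[mu]_(x in \bigcup_n exhaust n) (h x)%:E)%E.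
  apply: ge0_nondecreasing_set_cvg_integral.
  - move=> m n mn; apply/subsetPset => u; rewrite /exhaust/= !in_itv/=.
    move=> /andP[h1 h2]; apply/andP; split.
      by rewrite (le_trans _ h1)// lef_pV2 ?posrE ?ltr0Sn// ler_nat ltnS.
    by rewrite (le_trans h2)// ler_nat.
  - by move=> n; exact: measurable_itv.
  - move=> n; apply/measurable_EFinP.
    exact: (measurable_funS measurable_Rpos (@exhaust_sub n)).
  - by move=> n u /exhaust_sub; rewrite /= in_itv/= andbT lee_fin => /h0.
rewrite -(cvg_lim _ cv)//.
apply: (@le_lt_trans _ _ (M + M)%:E); last exact: ltry.
apply: lime_le; first by apply/cvg_ex; eexists; exact: cv.
apply: nearW => n; have b := exhaust_bounds n; have /andP[b0 b1] := b.
rewrite (FTC2_pos b dH ch) lee_fin lerD//.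
  by rewrite (le_trans (ler_norm _))// HM// (lt_trans b0).
by rewrite (le_trans (ler_norm _))// normrN HM.
Qed.

Lemma Rintegral_primitive h H (a b : R) :
  (forall u : R, 0 < u -> is_derive u (1 : R) H (h u)) ->
  (forall u : R, 0 < u -> {for u, continuous h}) ->
  mu.-integrable Rpos (EFin \o h) ->
  H n.+1%:R^-1 @[n --> \oo] --> a -> H n.+2%:R @[n --> \oo] --> b ->
  Rintegral mu Rpos h = b - a.
Proof.
move=> dH ch ih Ha Hb.
have mh := measurable_continuous_pos ch.
have : Rintegral mu Rpos (h \_ (exhaust n)) @[n --> \oo] --> Rintegral mu Rpos h.
  apply: (@Rintegral_dct R Rpos (fun n => h \_ (exhaust n)) h
    (Num.Def.normr \o h) measurable_Rpos _ _ _ _).2.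
  - move=> n; apply/measurable_restrict => //; first exact: measurable_itv.
    by apply: (measurable_funS measurable_Rpos _ mh); exact: subIsetl.
  - move=> t; rewrite /= in_itv/= andbT => /exhaust_near tn.
    apply: cvg_near_cst; apply: filterS tn => n tn.
    by rewrite patchE mem_set.
  - exact: integrable_norm.
  - by move=> n t _; rewrite patchE; case: ifP => //= _; rewrite normr0.
have -> : (fun n => Rintegral mu Rpos (h \_ (exhaust n))) =
    (fun n => H n.+2%:R - H n.+1%:R^-1).
  apply/funext => n; rewrite -Rintegral_mkcondr.
  rewrite (_ : Rpos `&` exhaust n = exhaust n); last exact/setIidr/exhaust_sub.
  by rewrite /Rintegral (FTC2_pos (exhaust_bounds n) dH ch).
move=> h1; exact: (cvg_unique _ h1 (cvgB Hb Ha)).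
Qed.

(** The inequality ln y <= y - 1 at y = m u / b. *)
Lemma ln_affine_bound (b m : R) : 0 < b -> 0 < m ->
  exists c, forall u : R, 0 < u -> b * ln u <= m * u + c.
Proof.
move=> b0 m0; exists (- b - b * ln (m / b)) => u u0.
have q0 : 0 < m / b by rewrite divr_gt0.
have y0 : 0 < u * (m / b) by rewrite mulr_gt0.
have hy : -1 < u * (m / b) - 1 by lra.
have := le_ln1Dx hy; rewrite [1 + (_ - 1)]addrC subrK lnM ?posrE//.
rewrite -(ler_pM2l b0).
have -> : b * (u * (m / b) - 1) = m * u - b by field; rewrite gt_eqF.
by lra.
Qed.

(** This is u^(s-1) exp (- a u), written so that products of powers become sums
    of exponents. *)
Definition gdens (s a u : R) : R := expR ((s - 1) * ln u - a * u).

Lemma gdens_ge0 s a u : 0 <= gdens s a u.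
Proof. exact: expR_ge0. Qed.

Lemma continuous_gdens (s a u : R) : 0 < u -> {for u, continuous (gdens s a)}.
Proof.
move=> u0; apply: (@continuous_comp _ _ _ (fun u => (s - 1) * ln u - a * u) expR);
  last exact: continuous_expR.
apply: cvgB; apply: cvgM; try exact: cvg_cst; last exact: cvg_id.
exact: continuous_ln.
Qed.

(** Comparison with the derivative of (u / (1 + u))^s, a bounded primitive that
    handles both ends of the half-line at once. *)
Lemma integrable_gdens (s a : R) : 0 < s -> 0 < a ->
  mu.-integrable Rpos (EFin \o gdens s a).
Proof.
move=> s0 a0.
pose H u : R := expR (s * (ln u - ln (1 + u))).
pose h u : R := s * (u^-1 - (1 + u)^-1) * H u.
have dH (u : R) : 0 < u -> is_derive u (1 : R) H (h u).
  move=> u0.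
  have d1 : is_derive u (1 : R) (fun u : R => ln (1 + u)) (1 + u)^-1.
    have u1 : 0 < 1 + u by lra.
    have d1 : is_derive u (1 : R) (fun u : R => 1 + u) 1.
      by apply: (is_derive_eq (is_deriveD (is_derive_cst _ _ _) (is_derive_id _ _))); rewrite add0r.
    apply: (is_derive_eq (@is_derive1_comp _ (@ln R) _ _ _ _ (is_derive1_ln u1) d1)).
    by rewrite mulr1.
  have d2 := is_deriveZ s (is_deriveB (is_derive1_ln u0) d1).
  apply: (is_derive_eq (@is_derive1_comp _ expR _ _ _ _ (is_derive_expR _) d2)).
  by rewrite /h /H /GRing.scale /= mulrC.
have hE (u : R) : 0 < u -> h u = s * expR ((s - 1) * ln u - (s + 1) * ln (1 + u)).
  move=> u0; have u1 : 0 < 1 + u by lra.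
  have -> : (s - 1) * ln u - (s + 1) * ln (1 + u) =
     s * (ln u - ln (1 + u)) - ln u - ln (1 + u) by ring.
  rewrite !expRD -/(H u) !expRN !lnK// /h.
  by field; rewrite !gt_eqF.
have ch (u : R) : 0 < u -> {for u, continuous h}.
  move=> u0; have u1 : 0 < 1 + u by lra.
  apply: cvgM.
    apply: cvgM; first exact: cvg_cst.
    apply: cvgB.
      by apply: cvgV; [rewrite gt_eqF|exact: cvg_id].
    apply: cvgV; first by rewrite gt_eqF.
    by apply: cvgD; [exact: cvg_cst|exact: cvg_id].
  have [d _] := dH _ u0.
  by apply: differentiable_continuous; exact/derivable1_diffP.
have h0 (u : R) : 0 < u -> 0 <= h u.
  by move=> u0; rewrite hE// mulr_ge0 ?expR_ge0// ltW.
have H1 (u : R) : 0 < u -> `|H u| <= 1.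
  move=> u0; rewrite ger0_norm ?expR_ge0// expR_le1.
  by rewrite mulr_ge0_le0 ?(ltW s0)// subr_le0 ler_ln ?posrE; lra.
have ih := integrable_bounded_primitive dH ch h0 H1.
have [c hc] := @ln_affine_bound (s + 1) a (addr_gt0 s0 ltr01) a0.
have ihZ : mu.-integrable Rpos (fun u => ((expR (a + c) / s)%:E * (h u)%:E)%E).
  by apply: (integrableZl _ (expR (a + c) / s) ih); exact: measurable_Rpos.
apply: (le_integrable _ _ _ ihZ).
- exact: measurable_Rpos.
- apply/measurable_EFinP.
  exact: (measurable_continuous_pos (fun u u0 => @continuous_gdens s a u u0)).
- move=> u /RposP u0.
  rewrite lee_fin ger0_norm ?gdens_ge0// ger0_norm; last first.
    by rewrite mulr_ge0 ?h0// divr_ge0 ?expR_ge0// ltW.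
  rewrite hE// mulrA divfK ?gt_eqF// -expRD ler_expR.
  have u1 : 0 < 1 + u by lra.
  by have := hc _ u1; lra.
Qed.

Lemma gdensE (s a u : R) : 0 < u ->
  expR (s * ln u - a * u) * u^-1 = gdens s a u.
Proof.
move=> u0; have -> : u^-1 = expR (- ln u) by rewrite expRN lnK.
by rewrite -expRD /gdens; congr expR; ring.
Qed.

Lemma gdens_mul (b s a u : R) :
  expR (b * ln u) * gdens s a u = gdens (s + b) a u.
Proof. by rewrite -expRD; congr expR; ring. Qed.

Lemma integrableZ_gdens (c s a : R) : 0 < s -> 0 < a ->
  mu.-integrable Rpos (EFin \o (fun u => c * gdens s a u)).
Proof.
move=> s0 a0; apply: (integrableZl _ c (integrable_gdens s0 a0)).
exact: measurable_Rpos.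
Qed.

Lemma integrableD_real (f g : R -> R) :
  mu.-integrable Rpos (EFin \o f) -> mu.-integrable Rpos (EFin \o g) ->
  mu.-integrable Rpos (EFin \o (fun u => f u + g u)).
Proof. by move=> fi gi; apply: (integrableD _ fi gi); exact: measurable_Rpos. Qed.

End HalfLine.

(** * Rotation of the contour of integration *)
Section Rotation.
Context {R : realType}.
Local Notation mu := (@lebesgue_measure R).
Local Notation Rpos := (`]0, +oo[%classic : set R).

(** The derivative in s may be taken under the integral sign, where it
    integrates to 0. *)
Lemma Rintegral_parameter_constant (f f' : R -> R -> R) (G : R -> R) (a b : R) :
  a < 0 -> 1 < b ->
  (forall s, a < s < b -> mu.-integrable Rpos (EFin \o f s)) ->
  (forall s u : R, a < s < b -> 0 < u -> is_derive s (1 : R) (f ^~ u) (f' s u)) ->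
  (forall s u : R, a < s < b -> 0 < u -> `|f' s u| <= G u) ->
  (forall u, 0 <= G u) ->
  mu.-integrable Rpos (EFin \o G) ->
  (forall s, a < s < b -> Rintegral mu Rpos (f' s) = 0) ->
  Rintegral mu Rpos (f 0) = Rintegral mu Rpos (f 1).
Proof.
move=> a0 b1 fi fd fG G0 iG f'0.
pose I s := Rintegral mu Rpos (f s).
have mRpos : measurable (Rpos : set (measurableTypeR R)) by exact: measurable_Rpos.
have ab s : `]a, b[%classic s -> a < s < b by rewrite /= in_itv.
have dfE s u : a < s < b -> 0 < u -> partial1of2 f s u = f' s u.
  by move=> sab u0; rewrite partial1of2E; have [_ ->] := fd s u sab u0.
have dI s : a < s < b -> is_derive s (1 : R) I 0.
  move=> sab.
  have Ia : `]a, b[%classic s by rewrite /= in_itv.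
  have fi' x : `]a, b[%classic x -> mu.-integrable Rpos (EFin \o f x).
    by move=> /ab; exact: fi.
  have fd' x y : `]a, b[%classic x -> Rpos y -> derivable (f ^~ y) x 1.
    by move=> /ab xab /RposP y0; have [] := fd x y xab y0.
  have fG' x y : `]a, b[%classic x -> Rpos y -> `|partial1of2 f x y| <= G y.
    by move=> /ab xab /RposP y0; rewrite dfE// fG.
  have dv := derivable_under_integral mRpos Ia fi' fd' G0 iG fG'.
  have de := differentiation_under_integral mRpos Ia fi' fd' G0 iG fG'.
  apply: DeriveDef; first exact: dv.
  rewrite -derive1E de -[RHS](f'0 s sab); apply: eq_Rintegral => y.
  by rewrite inE => /RposP y0; rewrite dfE.
have h01 (s : R) : s \in `]0, 1[ -> is_derive s (1 : R) I (cst 0 s).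
  by rewrite in_itv/= => /andP[s0 s1]; apply: dI; apply/andP; split; lra.
have [|c _] := MVT ltr01 h01.
  apply: continuous_in_subspaceT => s; rewrite inE/= in_itv/= => /andP[s0 s1].
  have [|d _] := dI s; first by apply/andP; split; lra.
  by apply: differentiable_continuous; exact/derivable1_diffP.
by rewrite /= mul0r => /eqP; rewrite subr_eq0 => /eqP.
Qed.

Variables (z p : R[i]) (eps kap : R).
Hypothesis hz : 0 < complex.Re z.
Hypothesis hp : 0 < complex.Re p.
Hypothesis heps : 0 <= eps.
Hypothesis hkap : 1 < kap.
Hypothesis hkapp : kap * kap * `|carg p| < pi / 2.

Local Notation L := (clog p).
Local Notation sg := (complex.Re z).
Local Notation tau := (complex.Im z).
Local Notation l := (ln (cmod p)).
Local Notation phi := (carg p).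

(** At w = ln u this is u^z exp (- p u - eps u^kap). *)
Definition Phi (w : R[i]) : R[i] :=
  cexp (z * w - p * cexp w - eps%:C * cexp (kap%:C * w)).

Definition dPhi (w : R[i]) : R[i] :=
  (z - p * cexp w - eps%:C * (kap%:C * cexp (kap%:C * w))) * Phi w.

(** The exponential of this path runs through the positive axis for s = 0 and,
    for s = 1, through the ray of the points u / p, on which multiplication by p
    gives positive numbers. *)
Definition spath (s u : R) : R[i] := (ln u)%:C - s%:C * L.

Lemma is_cderive_Phi (f : R -> R[i]) (x : R) d : is_cderive f x d ->
  is_cderive (fun t => Phi (f t)) x (d * dPhi (f x)).
Proof.
move=> fd; rewrite /dPhi /Phi.
have h1 := is_cderiveZ z fd.
have h2 := is_cderiveZ (- p) (is_cderive_cexp fd).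
have h3 := is_cderiveZ (- eps%:C) (is_cderive_cexp (is_cderiveZ kap%:C fd)).
have h := is_cderive_cexp (is_cderiveD (is_cderiveD h1 h2) h3).
have -> : (fun t => cexp (z * f t - p * cexp (f t) - eps%:C * cexp (kap%:C * f t)))
  = (fun t => cexp (z * f t + - p * cexp (f t) + - eps%:C * cexp (kap%:C * f t))).
  by apply/funext => t; congr cexp; ring.
apply: is_cderive_eq h _.
have -> : z * f x + - p * cexp (f x) + - eps%:C * cexp (kap%:C * f x) =
  z * f x - p * cexp (f x) - eps%:C * cexp (kap%:C * f x) by ring.
by ring.
Qed.

Lemma is_cderive_dPhi (f : R -> R[i]) (x : R) d : is_cderive f x d ->
  exists d', is_cderive (fun t => dPhi (f t)) x d'.
Proof.
move=> fd; rewrite /dPhi.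
have h2 := is_cderiveZ (- p) (is_cderive_cexp fd).
have h3 := is_cderiveZ (- eps%:C) (is_cderiveZ kap%:C (is_cderive_cexp (is_cderiveZ kap%:C fd))).
have h := is_cderiveM (is_cderiveD (is_cderiveD (is_cderive_cst z x) h2) h3) (is_cderive_Phi fd).
eexists.
have -> : (fun t => (z - p * cexp (f t) - eps%:C * (kap%:C * cexp (kap%:C * f t))) * Phi (f t)) =
 (fun t => (z + - p * cexp (f t) + - eps%:C * (kap%:C * cexp (kap%:C * f t))) * Phi (f t)).
  by apply/funext => t; ring.
exact: h.
Qed.

Lemma is_cderive_path_u (s u : R) : 0 < u ->
  is_cderive (spath s) u (u^-1)%:C.
Proof.
move=> u0.
have := is_cderiveD (is_cderive_real (is_derive1_ln u0)) (is_cderive_cst (- (s%:C * L)) u).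
by rewrite addr0.
Qed.

Lemma is_cderive_path_s (s u : R) : is_cderive (spath ^~ u) s (- L).
Proof.
have h1 := is_cderiveM (is_cderive_real (is_derive_id s (1 : R))) (is_cderive_cst L s).
have := is_cderiveD (is_cderive_cst (ln u)%:C s) (is_cderiveZ (-1) h1).
rewrite (_ : (fun t => (ln u)%:C + -1 * (t%:C * L)) = spath ^~ u); last first.
  by apply/funext => t; rewrite /spath mulN1r.
by move=> h; apply: is_cderive_eq h _; rewrite /=; ring.
Qed.

(* A decay rate and constants that are valid for all s between 1 - kap and kap. *)
Local Notation m := (expR (- (kap * `|l|)) * cos (kap * `|phi|)).
Local Notation C1 := (expR (kap * (sg * `|l| + `|tau * phi|))).
Local Notation K1 := (expR (kap * `|l|)).
Local Notation K2 := (eps * kap * expR (kap * kap * `|l|)).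

Let kp : kap * `|phi| < pi / 2.
Proof.
have k0 : 0 <= kap by have := hkap; lra.
by apply: le_lt_trans hkapp; rewrite -mulrA ler_peMl ?mulr_ge0// ltW.
Qed.

Let m_gt0 : 0 < m.
Proof.
rewrite mulr_gt0 ?expR_gt0// cos_gt0_pihalf// kp andbT.
have k0 : 0 <= kap by have := hkap; lra.
rewrite (@lt_le_trans _ _ 0)// ?mulr_ge0//.
by rewrite oppr_lt0 divr_gt0// pi_gt0.
Qed.

(** Along the path, p e^w has modulus u |p|^(1-s) and argument (1 - s) arg p,
    while e^(kap w) has argument - kap s arg p. For these s, in
    absolute value, the first argument stays away from pi / 2 and the second one
    does not exceed pi / 2, which gives
    exponential decay in u and a harmless regularising term. *)
Lemma Phi_bound (s u : R) : 1 - kap < s < kap -> 0 < u ->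
  [/\ cmod (Phi (spath s u)) <= C1 * expR (sg * ln u - m * u),
      cmod (p * cexp (spath s u)) <= K1 * u &
      cmod (cexp (kap%:C * spath s u)) <= expR (kap * kap * `|l|) * expR (kap * ln u)].
Proof.
move=> /andP[s1 s2] u0; have hk := hkap.
have sk : `|s| <= kap by rewrite ler_norml; apply/andP; split; lra.
have sk' : `|1 - s| <= kap by rewrite ler_norml; apply/andP; split; lra.
have k0 : 0 <= kap by have := hkap; lra.
have RL : complex.Re L = l by [].
have IL : complex.Im L = phi by [].
have hw : complex.Re (spath s u) = ln u - s * l.
  by rewrite /spath !cReImE /= ?RL; ring.
have hw' : complex.Im (spath s u) = - (s * phi).
  by rewrite /spath !cReImE /= ?IL; ring.
have pE : p * cexp (spath s u) = cexp ((ln u)%:C + (1 - s)%:C * L).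
  rewrite -{1}(cexp_clog hp) -cexpD; congr cexp; rewrite /spath rmorphB rmorph1.
  by ring.
have sl a b : `|a| <= kap -> a * b <= kap * `|b|.
  by move=> ak; rewrite (le_trans (ler_norm _))// normrM ler_wpM2r.
split.
- rewrite /Phi cmod_cexp -expRD ler_expR pE.
  rewrite !cReD !cReN Re_cexp [complex.Re (eps%:C * _)]cRe_realM Re_cexp.
  rewrite [complex.Re (z * _)]cReM cRe_realM cIm_realM hw hw'.
  rewrite cReD cImD cRe_realM cIm_realM /= add0r.
  have h1 : sg * (ln u - s * l) - tau * (- (s * phi)) <=
      kap * (sg * `|l| + `|tau * phi|) + sg * ln u.
    have e1 : - (s * l) <= kap * `|l| by rewrite -mulNr sl// normrN.
    have e2 : s * (tau * phi) <= kap * `|tau * phi| by exact: sl.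
    have : sg * (- (s * l)) <= sg * (kap * `|l|) by rewrite ler_wpM2l// ltW.
    by move=> e3; lra.
  have h2 : m * u <= expR (ln u + (1 - s) * l) * cos ((1 - s) * phi).
    rewrite expRD lnK ?posrE//.
    rewrite [leLHS]mulrC mulrA -subr_ge0 -!mulrA -!mulrBr mulr_ge0 ?(ltW u0)//.
    rewrite subr_ge0 ler_pM ?expR_ge0//.
    + by rewrite cos_ge0_pihalf// (ltW kp) andbT (@le_trans _ _ 0)// ?mulr_ge0// oppr_le0 divr_ge0// pi_ge0.
    + by rewrite ler_expR -[leRHS]opprK lerN2 -mulNr sl// normrN.
    + rewrite -[leRHS]cos_norm normrM.
      have pp := @pi_gt0 R.
      have k1 : `|1 - s| * `|phi| <= kap * `|phi| by rewrite ler_wpM2r.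
      have k2 : 0 <= `|1 - s| * `|phi| by rewrite mulr_ge0.
      move: (kp) k1 k2; set A := `|_| * `|_|; set B := kap * _ => kB k1 k2.
      rewrite le_eqVlt; case: (ltgtP A B) k1 => // [AB _|-> _]; last by rewrite eqxx.
      by rewrite ltr_cos ?AB ?orbT// in_itv/=; apply/andP; split; lra.
  have h3 : 0 <= eps * (expR (kap * (ln u - s * l)) * cos (kap * - (s * phi))).
    rewrite mulr_ge0// mulr_ge0 ?expR_ge0//.
    rewrite cos_ge0_pihalf// -ler_norml normrM normrN normrM ger0_norm//.
    apply: le_trans (ltW hkapp); rewrite -mulrA ler_wpM2l// ler_wpM2r//.
  by lra.
- rewrite pE cmod_cexp !cReImE /= ?RL mul0r subr0 expRD lnK ?posrE// mulrC.
  by rewrite ler_wpM2r ?(ltW u0)// ler_expR sl.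
- rewrite cmod_cexp cRe_realM hw -expRD ler_expR mulrBr.
  have : - (s * l) <= kap * `|l| by rewrite -mulNr sl// normrN.
  by move=> e; have := ler_wpM2l k0 e; lra.
Qed.

(** The factor is u^-1 because du / u is invariant under dilations: the
    derivatives of Phi along the path in s and in ln u are then proportional. *)
Definition kern (s u : R) : R[i] := (u^-1)%:C * Phi (spath s u).

(** The derivative in u of Phi along the path and also, up to the factor
    - clog p, the derivative in s of [kern]. *)
Definition dkern (s u : R) : R[i] := (u^-1)%:C * dPhi (spath s u).

Local Notation GB := (fun u : R => C1 * (cmod z * gdens sg m u +
  (K1 * gdens (sg + 1) m u + K2 * gdens (sg + kap) m u))).

Lemma kern_bound (s u : R) : 1 - kap < s < kap -> 0 < u ->
  cmod (kern s u) <= C1 * gdens sg m u.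
Proof.
move=> hs u0; have [h1 _ _] := Phi_bound hs u0.
have ui : 0 <= u^-1 by rewrite invr_ge0 ltW.
rewrite /kern cmodM cmod_real (ger0_norm ui) mulrC -gdensE// mulrA.
by rewrite ler_wpM2r.
Qed.

Lemma dkern_bound (s u : R) : 1 - kap < s < kap -> 0 < u ->
  cmod (dkern s u) <= GB u.
Proof.
move=> hs u0; have [_ h2 h3] := Phi_bound hs u0; have h1 := kern_bound hs u0.
have k0 : 0 <= kap by have := hkap; lra.
rewrite /dkern /dPhi mulrCA cmodM -/(kern s u).
have -> : GB u = (cmod z + (K1 * u + K2 * expR (kap * ln u))) * (C1 * gdens sg m u).
  rewrite /= -(gdens_mul kap) -(gdens_mul 1) mul1r lnK ?posrE//.
  by ring.
apply: ler_pM => //; try exact: cmod_ge0.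
rewrite (le_trans (cmodD _ _))// cmodN addrA lerD//.
  by rewrite (le_trans (cmodD _ _))// cmodN lerD.
rewrite cmodM cmod_real [cmod (kap%:C * _)]cmodM cmod_real.
rewrite (ger0_norm heps) (ger0_norm k0) mulrA -[leRHS]mulrA.
by rewrite ler_wpM2l// mulr_ge0.
Qed.

Lemma GB_ge0 u : 0 <= GB u.
Proof.
have k0 : 0 <= kap by have := hkap; lra.
by rewrite mulr_ge0 ?expR_ge0// !addr_ge0// !mulr_ge0 ?expR_ge0 ?cmod_ge0 ?gdens_ge0.
Qed.

Lemma integrable_GB : mu.-integrable Rpos (EFin \o GB).
Proof.
have kk := hkap; have s0 := hz.
have h : mu.-integrable Rpos (EFin \o (fun u : R => cmod z * gdens sg m u +
  (K1 * gdens (sg + 1) m u + K2 * gdens (sg + kap) m u))).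
  apply: integrableD_real; first exact: integrableZ_gdens.
  by apply: integrableD_real; apply: integrableZ_gdens => //; lra.
by apply: (integrableZl _ C1 h); exact: measurable_Rpos.
Qed.

Lemma cmeasurable_kern s : cmeasurable Rpos (kern s).
Proof.
apply: cmeasurable_cderivable => u u0; have [d1 h1] := is_cderive_inv_real u0.
by eexists; apply: (is_cderiveM h1 (is_cderive_Phi (is_cderive_path_u s u0))).
Qed.

Lemma is_cderive_dkern (s u : R) : 0 < u ->
  exists d, is_cderive (dkern s) u d.
Proof.
move=> u0; have [d1 h1] := is_cderive_inv_real u0.
have [d2 h2] := is_cderive_dPhi (is_cderive_path_u s u0).
by eexists; apply: (is_cderiveM h1 h2).
Qed.

Lemma cintegrable_kern (s : R) : 1 - kap < s < kap -> cintegrable Rpos (kern s).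
Proof.
move=> hs; apply: (cintegrable_dominated (g := fun u => C1 * gdens sg m u)).
- exact: measurable_Rpos.
- exact: cmeasurable_kern.
- by move=> u /RposP u0; exact: kern_bound.
- exact: integrableZ_gdens.
Qed.

Lemma cintegrable_dkern (s : R) : 1 - kap < s < kap ->
  cintegrable Rpos (dkern s).
Proof.
move=> hs; apply: (cintegrable_dominated (g := GB)).
- exact: measurable_Rpos.
- by apply: cmeasurable_cderivable => u u0; exact: is_cderive_dkern.
- by move=> u /RposP u0; exact: dkern_bound.
- exact: integrable_GB.
Qed.

Lemma Phi_cvg0 (s : R) : 1 - kap < s < kap ->
  (cmod (Phi (spath s n.+1%:R^-1)) @[n --> \oo] --> (0 : R)) /\
  (cmod (Phi (spath s n.+2%:R)) @[n --> \oo] --> (0 : R)).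
Proof.
move=> hs; have m0 := m_gt0.
split.
- have ub n : 0 <= cmod (Phi (spath s n.+1%:R^-1)) <= C1 * ((n.+1%:R^-1) `^ sg).
    rewrite cmod_ge0/=.
    have u0 : 0 < n.+1%:R^-1 :> R by rewrite invr_gt0.
    have [h1 _ _] := Phi_bound hs u0; apply: (le_trans h1).
    rewrite ler_wpM2l ?expR_ge0// /powR gt_eqF// ler_expR gerBl.
    by rewrite mulr_ge0// ltW.
  apply: (squeeze0 ub).
  rewrite -[X in _ --> X](mulr0 C1); apply: cvgM; first exact: cvg_cst.
  have /cvg_at_rightP := powR_cvg0 hz; apply; split.
    by move=> n; rewrite invr_gt0.
  exact: cvg_harmonic.
- have s1 : 0 < sg + 1 by have := hz; lra.
  have [c hc] := ln_affine_bound s1 m0.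
  have ub n : 0 <= cmod (Phi (spath s n.+2%:R)) <= C1 * expR c * (n.+1%:R^-1).
    rewrite cmod_ge0/=.
    have u0 : 0 < n.+2%:R :> R by [].
    have [h1 _ _] := Phi_bound hs u0; apply: (le_trans h1).
    rewrite -[leRHS]mulrA ler_wpM2l ?expR_ge0//.
    apply: (@le_trans _ _ (expR (c - ln n.+2%:R))).
      by rewrite ler_expR; have := hc _ u0; lra.
    rewrite expRD expRN lnK ?posrE// ler_wpM2l ?expR_ge0//.
    by rewrite lef_pV2 ?posrE// ler_nat.
  apply: (squeeze0 ub).
  rewrite -[X in _ --> X](mulr0 (C1 * expR c)); apply: cvgM; first exact: cvg_cst.
  exact: cvg_harmonic.
Qed.

(** The primitive Phi vanishes at both ends of the path. *)
Lemma cintegral_dkern (s : R) : 1 - kap < s < kap ->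
  cintegral Rpos (dkern s) = 0.
Proof.
move=> hs; have [i1 i2] := cintegrable_dkern hs; have [c1 c2] := Phi_cvg0 hs.
have dP u : 0 < u -> is_cderive (fun t => Phi (spath s t)) u (dkern s u).
  by move=> u0; exact: is_cderive_Phi (is_cderive_path_u s u0).
apply: complex_ext => /=.
- rewrite -[RHS](subrr (0 : R)).
  apply: (@Rintegral_primitive _ (fun u => complex.Re (dkern s u))
    (fun u => complex.Re (Phi (spath s u)))).
  + by move=> u u0; have [] := dP u u0.
  + by move=> u u0; have [d /is_cderive_continuous[]] := is_cderive_dkern s u0.
  + exact: i1.
  + exact: (cvg0_le_cmod (fun n => Re_le_cmod _) c1).
  + exact: (cvg0_le_cmod (fun n => Re_le_cmod _) c2).
- rewrite -[RHS](subrr (0 : R)).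
  apply: (@Rintegral_primitive _ (fun u => complex.Im (dkern s u))
    (fun u => complex.Im (Phi (spath s u)))).
  + by move=> u u0; have [] := dP u u0.
  + by move=> u u0; have [d /is_cderive_continuous[]] := is_cderive_dkern s u0.
  + exact: i2.
  + exact: (cvg0_le_cmod (fun n => Im_le_cmod _) c1).
  + exact: (cvg0_le_cmod (fun n => Im_le_cmod _) c2).
Qed.

(** The derivative in s of the integral of [kern s] is - clog p times the integral
    of [dkern s]. *)
Lemma rotation : cintegral Rpos (kern 0) = cintegral Rpos (kern 1).
Proof.
have kk := hkap.
have dK (s u : R) : is_cderive (kern ^~ u) s (- L * dkern s u).
  have h := is_cderiveZ (u^-1)%:C (is_cderive_Phi (is_cderive_path_s s u)).
  by apply: is_cderive_eq h _; rewrite /dkern; ring.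
have KG (s u : R) : 1 - kap < s < kap -> 0 < u ->
    cmod (- L * dkern s u) <= cmod L * GB u.
  by move=> hs u0; rewrite cmodM cmodN ler_wpM2l ?cmod_ge0// dkern_bound.
have G0 u : 0 <= cmod L * GB u by rewrite mulr_ge0 ?cmod_ge0 ?GB_ge0.
have iG : mu.-integrable Rpos (EFin \o (fun u => cmod L * GB u)).
  by apply: (integrableZl _ (cmod L) integrable_GB); exact: measurable_Rpos.
have I0 s : 1 - kap < s < kap -> cintegral Rpos (fun u => - L * dkern s u) = 0.
  move=> hs; rewrite cintegralZ ?cintegral_dkern ?mulr0//.
  exact: cintegrable_dkern.
have n0 : 1 - kap < 0 by lra.
apply: complex_ext => /=.
- apply: (@Rintegral_parameter_constant (fun s u => complex.Re (kern s u))
    (fun s u => complex.Re (- L * dkern s u)) _ _ _ n0 hkap _ _ _ G0 iG).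
  + by move=> s /cintegrable_kern[].
  + by move=> s u _ _; have [] := dK s u.
  + by move=> s u hs u0; rewrite (le_trans (Re_le_cmod _))// KG.
  + by move=> s /I0/(congr1 (@complex.Re R)).
- apply: (@Rintegral_parameter_constant (fun s u => complex.Im (kern s u))
    (fun s u => complex.Im (- L * dkern s u)) _ _ _ n0 hkap _ _ _ G0 iG).
  + by move=> s /cintegrable_kern[].
  + by move=> s u _ _; have [] := dK s u.
  + by move=> s u hs u0; rewrite (le_trans (Im_le_cmod _))// KG.
  + by move=> s /I0/(congr1 (@complex.Im R)).
Qed.

End Rotation.

(** * The Gamma function and the regularised term integrals *)
Section GammaFacts.
Context {R : realType}.
Local Notation mu := (@lebesgue_measure R).
Local Notation Rpos := (`]0, +oo[%classic : set R).
Implicit Types (z p : R[i]).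

(** The integrand of Euler's integral, in exponential form. *)
Definition gkern z (u : R) : R[i] := cexp ((z - 1) * (ln u)%:C - u%:C).

Definition rGamma (s : R) : R := Rintegral mu Rpos (gdens s 1).

Lemma cmod_gkern z u : cmod (gkern z u) = gdens (complex.Re z) 1 u.
Proof.
rewrite /gkern cmod_cexp /gdens; congr expR.
by rewrite cReD cReM cReD !cReN /= mulr0 subr0 mul1r.
Qed.

Lemma gkern_cderivable z (u : R) : 0 < u -> exists d, is_cderive (gkern z) u d.
Proof.
move=> u0; rewrite /gkern; eexists; apply: is_cderive_cexp.
apply: is_cderiveD.
  exact: (is_cderiveZ (z - 1) (is_cderive_real (is_derive1_ln u0))).
rewrite (_ : (fun t : R => - t%:C) = (fun t : R => -1 * t%:C)); last first.
  by apply/funext => t; rewrite mulN1r.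
exact: (is_cderiveZ (-1) (is_cderive_real (is_derive_id u (1 : R)))).
Qed.

Lemma cintegrable_gkern z : 0 < complex.Re z -> cintegrable Rpos (gkern z).
Proof.
move=> hz; apply: (cintegrable_dominated (g := gdens (complex.Re z) 1)).
- exact: measurable_Rpos.
- by apply: cmeasurable_cderivable => u; exact: gkern_cderivable.
- by move=> u _; rewrite cmod_gkern.
- exact: integrable_gdens.
Qed.

Lemma GammaE z : 0 < complex.Re z -> Gamma z = cintegral Rpos (gkern z).
Proof.
move=> hz; rewrite /Gamma hz /Gamma_integral; apply: eq_cintegral => t /RposP t0.
by rewrite cpow_pos// -cexp_real -cexpD rmorphN.
Qed.

Lemma cintegral_real (f : R -> R) : cintegral Rpos (fun t => (f t)%:C) =
  (Rintegral mu Rpos f)%:C.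
Proof. by apply: complex_ext => //=; rewrite /Rintegral integral0. Qed.

Lemma gkern_real (s u : R) : gkern s%:C u = (gdens s 1 u)%:C.
Proof. by rewrite /gkern -cexp_real mul1r rmorphB rmorphM rmorphB. Qed.

Lemma Gamma_real (s : R) : 0 < s -> Gamma s%:C = (rGamma s)%:C.
Proof.
move=> s0; rewrite GammaE// -cintegral_real.
by apply: eq_cintegral => t _; exact: gkern_real.
Qed.

Lemma rGamma_ge0 (s : R) : 0 <= rGamma s.
Proof. by apply: Rintegral_ge0 => u _; exact: gdens_ge0. Qed.

(** The integrand is bounded below by a positive constant on [1, 2]. *)
Lemma rGamma_gt0 (s : R) : 0 < s -> 0 < rGamma s.
Proof.
move=> s0; pose c : R := expR (- (`|s - 1| * ln 2) - 2).
apply: (@lt_le_trans _ _ c); first exact: expR_gt0.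
have sub : (`[1, 2]%classic : set R) `<=` Rpos.
  by move=> u; rewrite /= !in_itv/= andbT => /andP[u1 _]; rewrite (lt_le_trans ltr01).
have mI : measurable (`[1, 2]%classic : set R) by exact: measurable_itv.
have ig := integrable_gdens s0 (ltr01 : (0 : R) < 1).
have igI : mu.-integrable `[1, 2] (EFin \o gdens s 1).
  by apply: (integrableS _ _ _ ig); [exact: measurable_Rpos|exact: mI|exact: sub].
have h1 : (\int[mu]_(u in `[1%R, 2%R]) (c%:E) <= \int[mu]_(u in `[1%R, 2%R]) (gdens s 1 u)%:E)%E.
  apply: ge0_le_integral => //.
  - by move=> u _; rewrite lee_fin expR_ge0.
  - by have /integrableP[] := igI.
  - move=> u; rewrite /= in_itv/= => /andP[u1 u2].
    have u0 : 0 < u by lra.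
    rewrite lee_fin ler_expR mul1r.
    have l0 : 0 <= ln u by rewrite ln_ge0.
    have l2 : ln u <= ln 2 by rewrite ler_ln ?posrE.
    have : - ((s - 1) * ln u) <= `|s - 1| * ln 2.
      rewrite (le_trans (ler_norm _))// normrN normrM (ger0_norm l0).
      by rewrite ler_wpM2l.
    by lra.
have h2 : (\int[mu]_(u in `[1%R, 2%R]) (gdens s 1 u)%:E <=
    \int[mu]_(u in Rpos) (gdens s 1 u)%:E)%E.
  apply: ge0_subset_integral => //.
  - by have /integrableP[] := ig.
  - by move=> u _; rewrite lee_fin gdens_ge0.
have h3 := le_trans h1 h2.
rewrite -lee_fin /rGamma /Rintegral fineK; last first.
  by apply: (integrable_fin_num _ ig); exact: measurable_Rpos.
have hm : lebesgue_measure (`[1, 2]%classic : set R) = 1%:E.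
  by rewrite lebesgue_measure_itv/= lte_fin ltr1n -EFinB; congr EFin; lra.
apply: le_trans h3; rewrite integral_cst//.
by rewrite [X in (_ * X)%E](_ : _ = 1%:E) ?mule1.
Qed.

Lemma spath0 p (u : R) : spath p 0 u = (ln u)%:C.
Proof. by rewrite /spath rmorph0 mul0r subr0. Qed.

Lemma spath1 p (u : R) : spath p 1 u = (ln u)%:C - clog p.
Proof. by rewrite /spath rmorph1 mul1r. Qed.

(** This is t^(z-1) exp (- p t - eps t^kap). *)
Definition tkern z p (eps kap t : R) : R[i] :=
  cexp ((z - 1) * (ln t)%:C - p * t%:C) *
  (expR (- (eps * expR (kap * ln t))))%:C.

Section Term.
Variables (z p : R[i]) (kap : R).
Hypothesis hz : 0 < complex.Re z.
Hypothesis hp : 0 < complex.Re p.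
Hypothesis hkap : 1 < kap.
Hypothesis hkapp : kap * kap * `|carg p| < pi / 2.
Local Notation L := (clog p).

Lemma kern0E (eps t : R) : 0 < t -> kern z p eps kap 0 t = tkern z p eps kap t.
Proof.
move=> t0; rewrite /kern /Phi spath0 cexp_ln// /tkern -cexp_real (cexp_lnV t0).
rewrite -[kap%:C * _]rmorphM/= cexp_real -!cexpD; congr cexp.
by rewrite rmorphN rmorphM/=; ring.
Qed.

(** The integrand u^(z-1) exp (- u) exp (- eps (u / p)^kap) that is left on the
    rotated ray once p^(-z) is taken out. *)
Definition regkern (eps u : R) : R[i] :=
  gkern z u * cexp (- (eps * expR (kap * ln u))%:C * cexp (- kap%:C * L)).

Lemma kern1E (eps u : R) : 0 < u ->
  kern z p eps kap 1 u = cexp (- z * L) * regkern eps u.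
Proof.
move=> u0; rewrite /kern /Phi spath1 /regkern /gkern (cexp_lnV u0).
have -> : p * cexp ((ln u)%:C - L) = u%:C.
  rewrite -{1}(cexp_clog hp) -cexpD -(cexp_ln u0); congr cexp.
  by ring.
have -> : cexp (kap%:C * ((ln u)%:C - L)) =
    (expR (kap * ln u))%:C * cexp (- kap%:C * L).
  by rewrite -cexp_real -cexpD rmorphM; congr cexp; ring.
rewrite -!cexpD; congr cexp.
by rewrite rmorphM/=; ring.
Qed.

(** The argument of p^(-kap) is at most pi / 2 in absolute value, so that the
    rotated regularising factor has modulus at most 1. *)
Lemma Re_reg_ge0 : 0 <= complex.Re (cexp (- kap%:C * L)).
Proof.
have hk := hkap.
rewrite Re_cexp mulr_ge0 ?expR_ge0// cos_ge0_pihalf// -ler_norml.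
rewrite mulNr cImN cIm_realM normrN normrM gtr0_norm; last lra.
apply: le_trans (ltW hkapp); rewrite -mulrA ler_peMl//; last lra.
by rewrite mulr_ge0//; lra.
Qed.

Lemma regkern_bound (eps u : R) : 0 <= eps ->
  cmod (regkern eps u) <= gdens (complex.Re z) 1 u.
Proof.
move=> e0; rewrite /regkern cmodM cmod_gkern cmod_cexp.
rewrite ler_piMr ?gdens_ge0// expR_le1 mulNr cReN cRe_realM oppr_le0.
by rewrite mulr_ge0 ?Re_reg_ge0// mulr_ge0 ?expR_ge0.
Qed.

Lemma cmeasurable_regkern (eps : R) : cmeasurable Rpos (regkern eps).
Proof.
apply: cmeasurable_cderivable => u u0; have [d1 h1] := gkern_cderivable z u0.
have h2 := is_cderive_cexp (is_cderiveZ kap%:C (is_cderive_real (is_derive1_ln u0))).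
have h3 := is_cderive_cexp (is_cderiveZ (- eps%:C * cexp (- kap%:C * L)) h2).
eexists.
rewrite (_ : regkern eps = (fun t => gkern z t *
    cexp (- eps%:C * cexp (- kap%:C * L) * cexp (kap%:C * (ln t)%:C)))).
  exact: (is_cderiveM h1 h3).
apply/funext => t; rewrite /regkern; congr (_ * cexp _).
by rewrite -[kap%:C * _%:C]rmorphM/= cexp_real rmorphM/=; ring.
Qed.

Lemma cintegrable_regkern (eps : R) : 0 <= eps -> cintegrable Rpos (regkern eps).
Proof.
move=> e0; apply: (cintegrable_dominated (g := gdens (complex.Re z) 1)).
- exact: measurable_Rpos.
- exact: cmeasurable_regkern.
- by move=> u _; exact: regkern_bound.
- exact: integrable_gdens.
Qed.

Lemma cintegrable_tkern (eps : R) : 0 <= eps ->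
  cintegrable Rpos (tkern z p eps kap).
Proof.
move=> e0; have hk := hkap; have h0 : 1 - kap < 0 < kap by lra.
apply: (eq_cintegrable _ _ (cintegrable_kern hz hp e0 hkap hkapp h0)).
- exact: measurable_Rpos.
- by move=> t /RposP t0; rewrite kern0E.
Qed.

Lemma cintegral_tkern (eps : R) : 0 <= eps ->
  cintegral Rpos (tkern z p eps kap) =
  cexp (- z * L) * cintegral Rpos (regkern eps).
Proof.
move=> e0; rewrite -cintegralZ; last 2 first.
- exact: measurable_Rpos.
- exact: cintegrable_regkern.
transitivity (cintegral Rpos (kern z p eps kap 0)).
  by apply: eq_cintegral => t /RposP t0; rewrite kern0E.
rewrite rotation//; apply: eq_cintegral => t /RposP t0.
by rewrite kern1E.
Qed.

Lemma cintegral_tkern_bound (eps : R) : 0 <= eps ->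
  cmod (cintegral Rpos (tkern z p eps kap)) <=
  2 * (cmod (cexp (- z * L)) * rGamma (complex.Re z)).
Proof.
move=> e0; rewrite cintegral_tkern// cmodM mulrCA ler_wpM2l ?cmod_ge0//.
apply: cmod_cintegral_le; first exact: measurable_Rpos.
- exact: cintegrable_regkern.
- by move=> u _; exact: regkern_bound.
- exact: integrable_gdens.
Qed.

Lemma cintegral_tkern_cvg (eps : nat -> R) : (forall n, 0 <= eps n) ->
  eps n @[n --> \oo] --> (0 : R) ->
  ccvg (fun n => cintegral Rpos (tkern z p (eps n) kap))
    (cexp (- z * L) * Gamma z).
Proof.
move=> e0 ecvg.
rewrite (_ : (fun n => _) = (fun n => cexp (- z * L) * cintegral Rpos (regkern (eps n)))); last first.
  by apply/funext => n; rewrite cintegral_tkern.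
apply: ccvgZ; rewrite GammaE//.
apply: (@cintegral_dct R Rpos (fun n => regkern (eps n)) (gkern z)
  (gdens (complex.Re z) 1) measurable_Rpos _ _ _ _).2.
- by move=> n; exact: cmeasurable_regkern.
- move=> t _; rewrite /regkern -[X in ccvg _ X]mulr1; apply: ccvgZ.
  rewrite -cexp0; apply: ccvg_cexp.
  rewrite (_ : (fun n => _) = (fun n => - (expR (kap * ln t))%:C * cexp (- kap%:C * L) * (eps n)%:C)); last first.
    by apply/funext => n; rewrite rmorphM/=; ring.
  rewrite -[X in ccvg _ X](mulr0 (- (expR (kap * ln t))%:C * cexp (- kap%:C * L))).
  by apply: ccvgZ; exact: ccvg_real ecvg.
- exact: integrable_gdens.
- by move=> n t _; exact: regkern_bound.
Qed.

End Term.

Lemma carg_pos (a : R) : 0 < a -> carg a%:C = 0.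
Proof. by move=> /clog_pos/(congr1 (@complex.Im R)). Qed.

(** For p = a and eps = 0 the rotation is the dilation by a; the exponent 2
    is an arbitrary admissible one. *)
Lemma rGamma_scale (s a : R) : 0 < s -> 0 < a ->
  Rintegral mu Rpos (gdens s a) = expR (- s * ln a) * rGamma s.
Proof.
move=> s0 a0.
have k0 : (2 : R) * 2 * `|carg a%:C| < pi / 2.
  by rewrite carg_pos// normr0 mulr0 divr_gt0// pi_gt0.
have h := @cintegral_tkern s%:C a%:C 2 s0 a0 (ltr1n _ 2) k0 0 (lexx 0).
have h1 : cintegral Rpos (tkern s%:C a%:C 0 2) = (Rintegral mu Rpos (gdens s a))%:C.
  rewrite -cintegral_real; apply: eq_cintegral => t _.
  rewrite /tkern mul0r oppr0 expR0 mulr1 /gdens -cexp_real.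
  by rewrite rmorphB rmorphM rmorphB rmorphM.
have h2 : cintegral Rpos (regkern s%:C a%:C 2 0) = (rGamma s)%:C.
  rewrite -cintegral_real; apply: eq_cintegral => t _.
  by rewrite /regkern mul0r oppr0 mul0r cexp0 mulr1 gkern_real.
move: h; rewrite h1 h2 clog_pos// -rmorphN -rmorphM/= cexp_real -rmorphM/=.
by move=> [].
Qed.

(** For p = 1 and eps = 0, the vanishing of the integral of [dkern] is the usual
    integration by parts. *)
Lemma GammaS z : 0 < complex.Re z -> Gamma (z + 1) = z * Gamma z.
Proof.
move=> hz.
have p0 : 0 < complex.Re (1%:C : R[i]) by rewrite /= ltr01.
have k0 : (2 : R) * 2 * `|carg 1%:C| < pi / 2.
  by rewrite carg_pos// normr0 mulr0 divr_gt0// pi_gt0.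
have h0 : 1 - 2 < (0 : R) < 2 by lra.
have h := cintegral_dkern hz p0 (lexx 0) (ltr1n _ 2) k0 h0.
have hz1 : 0 < complex.Re (z + 1) by rewrite cReD /=; lra.
have hd : cintegral Rpos (dkern z 1%:C 0 2 0) =
    cintegral Rpos (fun t => z * gkern z t + (-1) * gkern (z + 1) t).
  apply: eq_cintegral => t /RposP t0.
  have t00 : t%:C != 0 by rewrite -cmod_gt0 cmod_real gtr0_norm.
  rewrite /dkern /dPhi mulrCA -/(kern z 1%:C 0 2 0 t) kern0E//.
  rewrite spath0 cexp_ln// mul0r subr0 /tkern mul0r oppr0 expR0 mulr1.
  rewrite /gkern [(1 : R)%:C](rmorph1 (real_complex R)) !mul1r.
  have -> : cexp ((z + 1 - 1) * (ln t)%:C - t%:C) =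
     t%:C * cexp ((z - 1) * (ln t)%:C - t%:C).
    by rewrite -{2}(cexp_ln t0) -cexpD; congr cexp; ring.
  by ring.
have ig := cintegrable_gkern hz; have ig1 := cintegrable_gkern hz1.
have mR := measurable_Rpos (R := R).
move: h; rewrite hd cintegralD ?cintegralZ//; last 2 first.
- exact: cintegrableZ.
- exact: cintegrableZ.
by rewrite -!GammaE// mulN1r => /eqP; rewrite subr_eq0 => /eqP.
Qed.

Lemma rGammaS (s : R) : 0 < s -> rGamma (s + 1) = s * rGamma s.
Proof.
move=> s0; have h : 0 < complex.Re (s%:C : R[i]) by [].
have := GammaS h; rewrite -[X in _ + X](rmorph1 (real_complex R)) -rmorphD/=.
by rewrite !Gamma_real ?addr_gt0// -rmorphM/= => -[].
Qed.

End GammaFacts.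

(** * A lower bound for Gamma on horizontal half-lines *)
Section GammaLower.
Context {R : realType}.
Local Notation mu := (@lebesgue_measure R).
Local Notation Rpos := (`]0, +oo[%classic : set R).

Lemma norm_sin_le (y : R) : `|sin y| <= `|y|.
Proof.
wlog y0 : y / 0 < y => [h|].
  have [/h//|yn|<-] := ltgtP 0 y; last by rewrite sin0.
  by have := h (- y); rewrite sinN !normrN oppr_gt0; exact.
have [|c _] := @MVT R sin cos 0 y y0 (fun x _ => is_derive_sin x).
  by apply: continuous_subspaceT; exact: continuous_sin.
rewrite sin0 !subr0 => ->; rewrite normrM ler_piMl// ler_norml.
by rewrite cos_geN1 cos_le1.
Qed.

Lemma cos_ge_quadratic (x : R) : 1 - x ^+ 2 / 2 <= cos x.
Proof.
have -> : x = (x / 2) *+ 2 by rewrite -mulr_natr divfK.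
rewrite cos_mulr2n cos2sin2.
have : sin (x / 2) ^+ 2 <= (x / 2) ^+ 2.
  by rewrite -[leLHS]real_normK ?num_real// -[leRHS]real_normK ?num_real// lerXn2r ?nnegrE// norm_sin_le.
by rewrite -[(x / 2) *+ 2]mulr_natr; set y := x / 2; set q := sin y; nra.
Qed.

(** The right-hand side is the square of 2 (a - 1 / a) for a = exp (v / 2), and
    a >= 1 + v / 2. *)
Lemma sqr_le_expR (v : R) : v ^+ 2 <= 4 * (expR v + expR (- v) - 2).
Proof.
wlog v0 : v / 0 <= v => [h|].
  have [/h//|/ltW v0] := leP 0 v.
  have := h (- v); rewrite oppr_ge0 sqrrN opprK => /(_ v0).
  by rewrite [expR (- v) + _]addrC.
pose a := expR (v / 2); have a0 : 0 < a by exact: expR_gt0.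
have ea : expR v = a ^+ 2 by rewrite /a -expRM_natl; congr expR; lra.
have ha : 1 + v / 2 <= a by exact: expR_ge1Dx.
have ab : a * a^-1 = 1 by rewrite divff// gt_eqF.
have -> : 4 * (expR v + expR (- v) - 2) = (2 * (a - a^-1)) ^+ 2.
  by rewrite expRN ea; field; rewrite gt_eqF.
rewrite ler_pXn2r ?nnegrE//; last first.
  have : a^-1 <= 1 by rewrite invf_le1//; lra.
  by lra.
have : a^-1 * (1 + v / 2) <= 1.
  have ai0 : 0 <= a^-1 by rewrite invr_ge0 ltW.
  by have := ler_wpM2l ai0 ha; rewrite [a^-1 * a]mulrC ab.
set b := a^-1 => hb.
have b0 : 0 <= b by rewrite invr_ge0 ltW.
by nra.
Qed.

(** After multiplication by the phase s^(- i tau), the real part of Gamma is the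
    integral of cos (tau ln (t / s)) against the Gamma density, which concentrates near t = s.
    The cosine is at least 1 - 2 tau^2 (t / s + s / t - 2), and the integral of this
    lower bound is explicit by the functional equation. *)
Lemma Gamma_lower_large (s tau : R) : 1 < s ->
  rGamma s * (1 - 2 * tau ^+ 2 / (s - 1)) <= cmod (Gamma (s +i* tau)).
Proof.
move=> s1; have s0 : 0 < s by lra.
have sm : 0 < s - 1 by lra.
have hz : 0 < complex.Re (s +i* tau) by [].
have mR := measurable_Rpos (R := R).
(* The phase s^(- i tau). *)
pose w : R[i] := cexp (0 +i* (- (tau * ln s))).
have w1 : cmod w = 1 by rewrite /w cmod_cexp /= expR0.
have -> : cmod (Gamma (s +i* tau)) = cmod (w * Gamma (s +i* tau)).
  by rewrite cmodM w1 mul1r.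
apply: le_trans (Re_le_cmod _); apply: le_trans (ler_norm _).
rewrite GammaE// -cintegralZ//; last exact: cintegrable_gkern.
have [ir _] := cintegrableZ w mR (cintegrable_gkern hz).
have -> : complex.Re (cintegral Rpos (fun t => w * gkern (s +i* tau) t)) =
  Rintegral mu Rpos (fun t => complex.Re (w * gkern (s +i* tau) t)) by [].
have e1 : rGamma (s + 1) = s * rGamma s by exact: rGammaS.
have e2 : rGamma s = (s - 1) * rGamma (s - 1) by rewrite -rGammaS// subrK.
have i0 := integrable_gdens s0 (ltr01 : (0 : R) < 1).
have i1 := integrable_gdens (addr_gt0 s0 ltr01) (ltr01 : (0 : R) < 1).
have i2 := integrable_gdens sm (ltr01 : (0 : R) < 1).
have iA : mu.-integrable Rpos (EFin \o (fun t => (1 + 4 * tau ^+ 2) * gdens s 1 t)).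
  exact: integrableZ_gdens.
have iB : mu.-integrable Rpos (EFin \o (fun t => - (2 * tau ^+ 2 / s) * gdens (s + 1) 1 t)).
  apply: integrableZ_gdens => //; lra.
have iC : mu.-integrable Rpos (EFin \o (fun t => - (2 * tau ^+ 2 * s) * gdens (s - 1) 1 t)).
  exact: integrableZ_gdens.
have iBC := integrableD_real iB iC.
have iABC := integrableD_real iA iBC.
have -> : rGamma s * (1 - 2 * tau ^+ 2 / (s - 1)) = Rintegral mu Rpos (fun t =>
   (1 + 4 * tau ^+ 2) * gdens s 1 t + (- (2 * tau ^+ 2 / s) * gdens (s + 1) 1 t
     + - (2 * tau ^+ 2 * s) * gdens (s - 1) 1 t)).
  rewrite RintegralD// RintegralD// !RintegralZl//.
  rewrite -/(rGamma s) -/(rGamma (s + 1)) -/(rGamma (s - 1)) e1 e2.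
  by field; rewrite !gt_eqF.
apply: (le_Rintegral _ iABC ir) => // t /RposP t0.
rewrite /gkern /w -cexpD Re_cexp cImD cReD [complex.Re (0 +i* _)]/=.
rewrite [complex.Im (0 +i* _)]/=.
have -> : expR (0 + complex.Re ((s +i* tau - 1) * (ln t)%:C - t%:C)) = gdens s 1 t.
  by rewrite add0r -cmod_cexp -/(gkern _ _) cmod_gkern.
have -> : - (tau * ln s) + complex.Im ((s +i* tau - 1) * (ln t)%:C - t%:C) =
    tau * (ln t - ln s).
  by rewrite /=; ring.
have tE : gdens (s + 1) 1 t = t * gdens s 1 t.
  by rewrite -(gdens_mul 1) mul1r lnK.
have tE' : gdens (s - 1) 1 t = t^-1 * gdens s 1 t.
  by rewrite -(gdens_mul (-1)) mulN1r expRN lnK.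
rewrite tE tE'.
have -> : (1 + 4 * tau ^+ 2) * gdens s 1 t + (- (2 * tau ^+ 2 / s) * (t * gdens s 1 t)
     + - (2 * tau ^+ 2 * s) * (t^-1 * gdens s 1 t)) =
   gdens s 1 t * (1 - 2 * tau ^+ 2 * (t / s + s / t - 2)) by field; rewrite !gt_eqF.
rewrite ler_wpM2l ?gdens_ge0//.
apply: le_trans (cos_ge_quadratic _).
have := sqr_le_expR (ln t - ln s).
rewrite opprB !expRD !expRN !lnK ?posrE// => hq.
have := ler_wpM2l (sqr_ge0 tau) hq.
by rewrite exprMn; lra.
Qed.

(** The functional equation carries the bound for large s down to s0; each step
    costs at most the factor s0 / (s0 + |tau|), uniformly in s. *)
Lemma Gamma_lower (s0 tau : R) : 0 < s0 ->
  exists2 c : R, 0 < c & forall s, s0 <= s ->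
    c * rGamma s <= cmod (Gamma (s +i* tau)).
Proof.
move=> s00.
(* For s >= S the bound of [Gamma_lower_large] is at least rGamma s / 2. *)
pose S := 2 + 4 * tau ^+ 2.
pose k := s0 / (s0 + `|tau|).
have k0 : 0 < k by rewrite divr_gt0// ltr_pwDl.
suff P N : forall s, s0 <= s -> S <= s + N%:R ->
    k ^+ N / 2 * rGamma s <= cmod (Gamma (s +i* tau)).
  exists (k ^+ (Num.truncn S).+1 / 2); first by rewrite divr_gt0// exprn_gt0.
  move=> s hs; apply: P => //.
  by have := truncnS_gt S; lra.
elim: N => [|N ih] s hs hS.
  have s1 : 1 < s by rewrite /S addr0 in hS; have := sqr_ge0 tau; lra.
  apply: le_trans (Gamma_lower_large tau s1).
  rewrite expr0 mulrC ler_wpM2l ?rGamma_ge0//.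
  have h : 2 * tau ^+ 2 / (s - 1) <= 1 / 2.
    rewrite ler_pdivrMr; last lra.
    by rewrite /S addr0 in hS; lra.
  by lra.
have sp : 0 < s by lra.
have hz : 0 < complex.Re (s +i* tau) by [].
have ih1 : k ^+ N / 2 * rGamma (s + 1) <= cmod (Gamma ((s + 1) +i* tau)).
  apply: ih; first lra.
  by rewrite -[N.+1]add1n natrD in hS; lra.
have e : (s + 1) +i* tau = (s +i* tau) + 1 :> R[i].
  by apply: complex_ext; rewrite ?cReD ?cImD /= ?addr0.
rewrite e GammaS// cmodM rGammaS// in ih1.
set G := cmod (Gamma _) in ih1 *.
have zs : cmod (s +i* tau) <= s + `|tau|.
  by rewrite (le_trans (cmod_le_ReIm _))//= (gtr0_norm sp).
have G0 : 0 <= G by exact: cmod_ge0.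
have st : 0 < s + `|tau| by rewrite ltr_pwDl.
have ks : k * (s + `|tau|) <= s.
  rewrite /k mulrAC ler_pdivrMr; last by rewrite ltr_pwDl.
  rewrite !mulrDr; have : s0 * `|tau| <= s * `|tau| by rewrite ler_wpM2r.
  by lra.
have h2 : k ^+ N / 2 * (s * rGamma s) <= (s + `|tau|) * G.
  by apply: (le_trans ih1); rewrite ler_wpM2r.
rewrite -(ler_pM2l st); apply: le_trans h2.
have -> : (s + `|tau|) * (k ^+ N.+1 / 2 * rGamma s) =
   (k ^+ N / 2 * rGamma s) * (k * (s + `|tau|)) by rewrite exprS; ring.
have -> : k ^+ N / 2 * (s * rGamma s) = (k ^+ N / 2 * rGamma s) * s by ring.
by rewrite ler_wpM2l// mulr_ge0 ?rGamma_ge0// divr_ge0// exprn_ge0// ltW.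
Qed.

Lemma Gamma_neq0 (z : R[i]) : 0 < complex.Re z -> Gamma z != 0.
Proof.
case: z => s tau /= s0; have [c c0 h] := Gamma_lower tau s0.
rewrite -cmod_gt0; apply: lt_le_trans (h _ (lexx s)).
by rewrite mulr_gt0// rGamma_gt0.
Qed.

End GammaLower.

(** * Double series and dominated convergence of series *)
Section DoubleSeries.
Context {R : realType}.

Lemma nonneg_series_cvg (b : nat -> R) (S : R) : (forall k, 0 <= b k) ->
  (\esum_(k in [set: nat]) (b k)%:E = S%:E)%E -> series b @ \oo --> S.
Proof.
move=> b0 bS.
have b0' k : (0 <= (b k)%:E)%E by rewrite lee_fin.
have : (\sum_(0 <= k < n) (b k)%:E @[n --> \oo] --> S%:E)%E.
  by rewrite -bS -nneseries_esumT//; apply: is_cvg_nneseries => k _ _.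
rewrite (_ : series b = fine \o (fun n => \sum_(0 <= k < n) (b k)%:E)%E).
  exact: fine_cvg.
by apply/funext => n; rewrite /= sumEFin.
Qed.

Lemma nat2_enum : exists e : nat -> nat * nat, set_bij [set: nat] [set: nat * nat] e.
Proof.
have /card_esym/pcard_eqP/unsquash f := card_nat2.
by exists f; exact: bij.
Qed.

Section NonnegDouble.
Variables (e : nat -> nat * nat) (b : nat -> nat -> R).
Hypothesis he : set_bij [set: nat] [set: nat * nat] e.
Hypothesis b0 : forall m n, 0 <= b m n.
Hypothesis bfin : (\esum_(k in [set: nat * nat]) (b k.1 k.2)%:E < +oo)%E.

Let S := fine (\esum_(k in [set: nat * nat]) (b k.1 k.2)%:E).
Let Srow m := fine (\esum_(n in [set: nat]) (b m n)%:E).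

Let b0' m n : (0 <= (b m n)%:E)%E.
Proof. by rewrite lee_fin. Qed.

Let SE : (\esum_(k in [set: nat * nat]) (b k.1 k.2)%:E = S%:E)%E.
Proof. by rewrite fineK// ge0_fin_numE//; apply: esum_ge0 => k _; exact: b0'. Qed.

Let iterE : (\esum_(m in [set: nat]) \esum_(n in [set: nat]) (b m n)%:E = S%:E)%E.
Proof.
rewrite (esum_esum (I := [set: nat]) (J := fun=> [set: nat])) -?SE.
  by congr esum; apply/seteqP; split => //.
by move=> m n _ _; exact: b0'.
Qed.

Let SrowE m : (\esum_(n in [set: nat]) (b m n)%:E = (Srow m)%:E)%E.
Proof.
rewrite fineK// ge0_fin_numE; last by apply: esum_ge0 => n _; exact: b0'.
apply: le_lt_trans (ltry S); rewrite -iterE.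
apply: esum_ge; exists [set m]; first by split => //; exact: finite_set1.
by rewrite fsbig_set1.
Qed.

Lemma nonneg_enum_cvg : series (fun k => b (e k).1 (e k).2) @ \oo --> S.
Proof.
apply: nonneg_series_cvg => [k|]; first exact: b0.
by rewrite -SE (@reindex_esum R _ _ _ _ _ (fun k => (b k.1 k.2)%:E) he).
Qed.

Lemma nonneg_row_cvg m : series (b m) @ \oo --> Srow m.
Proof. by apply: nonneg_series_cvg => // k; exact: b0. Qed.

Lemma nonneg_rows_cvg : series Srow @ \oo --> S.
Proof.
apply: nonneg_series_cvg => [m|].
  by rewrite fine_ge0//; apply: esum_ge0 => n _; exact: b0'.
by rewrite -iterE; apply: eq_esum => m _; rewrite SrowE.
Qed.

End NonnegDouble.

Lemma seriesB_cvg (u v : nat -> R) a b : series u @ \oo --> a ->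
  series v @ \oo --> b -> series (fun k => u k - v k) @ \oo --> a - b.
Proof.
move=> ua vb; rewrite (_ : series _ = series u - series v); first exact: cvgB.
by apply/funext => n; rewrite !fctE /series/= sumrB.
Qed.

(** For nonnegative terms both sides are the sum over the set of all pairs; the
    general case follows by splitting into positive and negative parts. *)
Lemma rsum2_enum (e : nat -> nat * nat) (a : nat -> nat -> R) :
  set_bij [set: nat] [set: nat * nat] e ->
  summable [set: nat * nat] (fun k => (a k.1 k.2)%:E) ->
  series (fun k => a (e k).1 (e k).2) @ \oo --> rsum2 a.
Proof.
move=> he sa.
pose bp m n := Num.max (a m n) 0.
pose bn m n := Num.max (- a m n) 0.
have bp0 m n : 0 <= bp m n by rewrite le_max lexx orbT.
have bn0 m n : 0 <= bn m n by rewrite le_max lexx orbT.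
have aE m n : a m n = bp m n - bn m n.
  rewrite /bp /bn; case: (boolP (0 <= a m n)) => h.
    have h' : - a m n <= 0 by rewrite oppr_le0.
    by rewrite (max_idPl h) (max_idPr h') subr0.
  move: h; rewrite -ltNge => /ltW h.
  have h' : 0 <= - a m n by rewrite oppr_ge0.
  by rewrite (max_idPr h) (max_idPl h') sub0r opprK.
have bpf : (\esum_(k in [set: nat * nat]) (bp k.1 k.2)%:E < +oo)%E.
  apply: le_lt_trans sa; apply: le_esum => k _.
  by rewrite lee_fin ge_max ler_norm normr_ge0.
have bnf : (\esum_(k in [set: nat * nat]) (bn k.1 k.2)%:E < +oo)%E.
  apply: le_lt_trans sa; apply: le_esum => k _.
  by rewrite lee_fin ge_max normr_ge0 andbT -normrN ler_norm.
have rowE : (fun m => limn (series (a m))) = (fun m =>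
    fine (\esum_(n in [set: nat]) (bp m n)%:E) -
    fine (\esum_(n in [set: nat]) (bn m n)%:E)).
  apply/funext => m; apply/cvg_lim => //.
  rewrite (_ : a m = (fun n => bp m n - bn m n)); last exact/funext.
  by apply: seriesB_cvg; exact: nonneg_row_cvg.
have -> : rsum2 a = fine (\esum_(k in [set: nat * nat]) (bp k.1 k.2)%:E) -
    fine (\esum_(k in [set: nat * nat]) (bn k.1 k.2)%:E).
  rewrite /rsum2 rowE; apply/cvg_lim => //.
  by apply: seriesB_cvg; exact: nonneg_rows_cvg.
rewrite (_ : (fun k => a (e k).1 (e k).2) = (fun k =>
    bp (e k).1 (e k).2 - bn (e k).1 (e k).2)); last exact/funext.
by apply: seriesB_cvg; exact: nonneg_enum_cvg.
Qed.

Lemma csum2_enum (e : nat -> nat * nat) (a : nat -> nat -> R[i]) :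
  set_bij [set: nat] [set: nat * nat] e -> abs_summable2 a ->
  ccvg (fun N => \sum_(k < N) a (e k).1 (e k).2) (csum2 a).
Proof.
move=> he sa; split => /=.
- rewrite (_ : (fun N => _) = series (fun k => complex.Re (a (e k).1 (e k).2))).
    apply: (rsum2_enum (a := fun m n => complex.Re (a m n))) => //.
    apply: le_lt_trans sa; apply: le_esum => k _.
    by rewrite lee_fin (le_trans (Re_le_cmod _))// ler_norm.
  apply/funext => N.
  by rewrite (cRe_sum N (fun k => a (e k).1 (e k).2)) /series/= big_mkord.
- rewrite (_ : (fun N => _) = series (fun k => complex.Im (a (e k).1 (e k).2))).
    apply: (rsum2_enum (a := fun m n => complex.Im (a m n))) => //.
    apply: le_lt_trans sa; apply: le_esum => k _.
    by rewrite lee_fin (le_trans (Im_le_cmod _))// ler_norm.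
  apply/funext => N.
  by rewrite (cIm_sum N (fun k => a (e k).1 (e k).2)) /series/= big_mkord.
Qed.

Lemma abs_summable2_enum (e : nat -> nat * nat) (a : nat -> nat -> R[i]) :
  set_bij [set: nat] [set: nat * nat] e -> abs_summable2 a ->
  cvgn (series (fun k => cmod (a (e k).1 (e k).2))).
Proof.
move=> he sa; apply/cvg_ex; eexists.
apply: (nonneg_enum_cvg (b := fun m n => cmod (a m n)) he) => [m n|].
  exact: cmod_ge0.
apply: le_lt_trans sa; apply: le_esum => k _.
by rewrite lee_fin ler_norm.
Qed.

Lemma series_tail (u B : nat -> R) (U T : R) K : (forall k, `|u k| <= B k) ->
  series B @ \oo --> T -> series u @ \oo --> U ->
  `|U - series u K| <= T - series B K.
Proof.
move=> uB BT uU.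
have h1 : `|series u n - series u K| @[n --> \oo] --> `|U - series u K|.
  by apply: cvg_norm; apply: cvgB => //; exact: cvg_cst.
have h2 : series B n - series B K @[n --> \oo] --> T - series B K.
  by apply: cvgB => //; exact: cvg_cst.
apply: (ler_cvg_to h1 h2).
exists K => // n /= Kn.
rewrite !sub_series_geq// (le_trans (ler_norm_sum _ _ _))//.
by apply: ler_sum => k _.
Qed.

(** The series are cut at an index K beyond which the majorant contributes at most
    eps / 3. *)
Lemma tannery (u : nat -> nat -> R) (v B U : nat -> R) (V T : R) :
  (forall n k, `|u n k| <= B k) ->
  (forall k, u n k @[n --> \oo] --> v k) ->
  series B @ \oo --> T ->
  (forall n, series (u n) @ \oo --> U n) ->
  series v @ \oo --> V ->
  U n @[n --> \oo] --> V.
Proof.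
move=> uB uv BT uU vV.
have vB k : `|v k| <= B k.
  apply: (ler_cvg_to (cvg_norm (uv k)) (cvg_cst (B k))).
  by apply: nearW => n; exact: uB.
apply/cvgrPdist_le => eps eps0.
have e3 : 0 < eps / 3 by rewrite divr_gt0.
have [K _ hK] : \forall K \near \oo, `|T - series B K| <= eps / 3.
  by move/cvgrPdist_le : BT; exact.
have {}hK := hK K (leqnn K).
have cK : series (u n) K @[n --> \oo] --> series v K.
  rewrite /series/=; rewrite (_ : (fun n => _) = (fun n => \sum_(0 <= k < K) u n k))//.
  elim: {hK} K => [|K ih].
    rewrite big_nil; under eq_fun do rewrite big_nil.
    exact: cvg_cst.
  rewrite big_nat_recr//=; under eq_fun do rewrite big_nat_recr//=.
  by apply: cvgD.
move/cvgrPdist_le : cK => /(_ _ e3); apply: filterS => n hn.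
have t1 := series_tail K (uB n) BT (uU n).
have t2 := series_tail K vB BT vV.
have := ler_norm (T - series B K).
move: t1 t2 hn; rewrite !ler_norml => /andP[? ?] /andP[? ?] /andP[? ?] ?.
by apply/andP; split; lra.
Qed.

Lemma ctannery (u : nat -> nat -> R[i]) (v U : nat -> R[i]) (V : R[i]) (B : nat -> R) :
  (forall n k, cmod (u n k) <= B k) ->
  (forall k, ccvg (fun n => u n k) (v k)) ->
  cvgn (series B) ->
  (forall n, ccvg (fun N => \sum_(k < N) u n k) (U n)) ->
  ccvg (fun N => \sum_(k < N) v k) V ->
  ccvg U V.
Proof.
move=> uB uv /cvg_ex[T BT] uU vV; split.
- apply: (@tannery (fun n k => complex.Re (u n k)) (fun k => complex.Re (v k))
    B _ _ T) => //.
  + by move=> n k; rewrite (le_trans (Re_le_cmod _)).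
  + by move=> k; have [] := uv k.
  + move=> n; rewrite (_ : series _ = (fun N => complex.Re (\sum_(k < N) u n k))).
      by have [] := uU n.
    by apply/funext => N; rewrite cRe_sum /series/= big_mkord.
  + rewrite (_ : series _ = (fun N => complex.Re (\sum_(k < N) v k))).
      by have [] := vV.
    by apply/funext => N; rewrite cRe_sum /series/= big_mkord.
- apply: (@tannery (fun n k => complex.Im (u n k)) (fun k => complex.Im (v k))
    B _ _ T) => //.
  + by move=> n k; rewrite (le_trans (Im_le_cmod _)).
  + by move=> k; have [] := uv k.
  + move=> n; rewrite (_ : series _ = (fun N => complex.Im (\sum_(k < N) u n k))).
      by have [] := uU n.
    by apply/funext => N; rewrite cIm_sum /series/= big_mkord.
  + rewrite (_ : series _ = (fun N => complex.Im (\sum_(k < N) v k))).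
      by have [] := vV.
    by apply/funext => N; rewrite cIm_sum /series/= big_mkord.
Qed.

Lemma cvgn_seriesZ (c : R) (u : nat -> R) : cvgn (series u) ->
  cvgn (series (fun k => c * u k)).
Proof.
move=> /cvg_ex[l ul]; apply/cvg_ex; exists (c * l).
rewrite (_ : series _ = (fun n => c * series u n)).
  by apply: cvgM => //; exact: cvg_cst.
by apply/funext => n; rewrite /series/= mulr_sumr.
Qed.

Lemma cvgn_series_le (u v : nat -> R) : (forall k, 0 <= u k) ->
  (forall k, u k <= v k) -> cvgn (series v) -> cvgn (series u).
Proof.
by move=> u0 uv; apply: series_le_cvg => // k; exact: le_trans (u0 k) (uv k).
Qed.

End DoubleSeries.

Arguments cvgn_seriesZ {R} c {u} _.

(** * Abel summation of improper integrals *)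
Section LayerCake.
Context {R : realType}.
Local Notation mu := (@lebesgue_measure R).
Local Notation Rpos := (`]0, +oo[%classic : set R).
Local Notation U01 := (`]0, 1[%classic : set R).
Local Notation RR := (measurableTypeR R).

Variables (a phi T : R -> R).
Hypothesis ia : mu.-integrable Rpos (EFin \o (fun t => a t * phi t)).
Hypothesis ma : measurable_fun Rpos a.
Hypothesis mphi : measurable_fun [set: R] phi.
Hypothesis phi01 : forall t : R, 0 < t -> 0 < phi t < 1.
Hypothesis phiT : forall t v : R, 0 < t -> 0 < v < 1 -> (v <= phi t) = (t <= T v).

Let D : set (RR * RR) := [set z | 0 < z.2 <= phi z.1].

Let mD : measurable D.
Proof.
have -> : D = (fun z : RR * RR => z.2 : RR) @^-1` (`]0, +oo[%classic) `&`
    (fun z : RR * RR => phi z.1 - z.2 : RR) @^-1` (`[0, +oo[%classic).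
  apply/seteqP; split => [z /= /andP[z0 z1]|z /=].
    by rewrite !in_itv/= !andbT subr_ge0.
  by rewrite !in_itv/= !andbT subr_ge0 => -[z0 z1]; apply/andP.
apply: measurableI.
- rewrite -[X in measurable X]setTI; apply: (@measurable_snd _ _ RR RR) => //.
- rewrite -[X in measurable X]setTI.
  have h : measurable_fun [set: RR * RR] (fun z : RR * RR => phi z.1 - z.2).
    apply: measurable_funB; last exact: measurable_snd.
    by apply: (measurableT_comp mphi); exact: measurable_fst.
  apply: h => //.
Qed.

Let aP : R -> R := a \_ Rpos.

Let F (z : RR * RR) : \bar R := (aP z.1 * \1_D z)%:E.

Let mF : measurable_fun setT F.
Proof.
apply/measurable_EFinP; apply: measurable_funM.
  apply: (@measurableT_comp _ _ _ _ _ _ aP); last exact: measurable_fst.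
  by apply/(measurable_restrictT _ _).1 => //; exact: measurable_Rpos.
exact: measurable_indic.
Qed.

Let inner (t v : R) : F (t, v) = ((aP t)%:E * (\1_(`]0, phi t]%classic : set R) v)%:E)%E.
Proof.
rewrite /F -EFinM; congr (_ * _)%:E; rewrite !indicE; congr (_%:R).
Qed.

Let int_indic (t : R) : 0 < t ->
  (\int[mu]_v (\1_(`]0, phi t]%classic : set R) v)%:E = (phi t)%:E)%E.
Proof.
move=> t0; have /andP[p0 _] := phi01 t0.
rewrite integral_indic// setIT [LHS](_ : _ = lebesgue_measure (`]0, phi t]%classic : set R))//.
by rewrite lebesgue_measure_itv/= lte_fin p0 sube0.
Qed.

Let aP0 (t : R) : ~ 0 < t -> aP t = 0.
Proof. by move=> t0; rewrite /aP patchE memNset// => /RposP. Qed.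

Let aPE (t : R) : 0 < t -> aP t = a t.
Proof. by move=> t0; rewrite /aP patchE mem_set//= in_itv/= andbT. Qed.

Let int_inner (t : R) : (\int[mu]_v F (t, v) =
  (((fun t => a t * phi t) \_ Rpos) t)%:E)%E.
Proof.
under eq_integral do rewrite inner.
have mi : measurable (`]0, phi t]%classic : set R) by exact: measurable_itv.
case: (pselect (0 < t)) => t0; last first.
  rewrite aP0// patchE memNset; last by move=> /RposP.
  by under eq_integral do rewrite mul0e; rewrite integral0.
rewrite integralZl//; last first.
  apply/integrableP; split.
    by apply/measurable_EFinP; exact: measurable_indic.
  under eq_integral do rewrite /= ger0_norm//.
  by rewrite int_indic// ltry.
by rewrite int_indic// aPE// patchE mem_set ?EFinM//= in_itv/= andbT.
Qed.

Let int_inner_abs (t : R) : (\int[mu]_v `|F (t, v)| =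
  `|(((fun t => a t * phi t) \_ Rpos) t)%:E|)%E.
Proof.
under eq_integral do rewrite inner abseM.
case: (pselect (0 < t)) => t0; last first.
  rewrite aP0// patchE memNset; last by move=> /RposP.
  by under eq_integral do rewrite abse0 mul0e; rewrite integral0 abse0.
rewrite ge0_integralZl//.
- under eq_integral do rewrite /= ger0_norm//.
  rewrite int_indic// aPE// patchE mem_set//= ?in_itv/= ?andbT//.
  by rewrite -EFinM normrM [`|phi t|]gtr0_norm//; case/andP: (phi01 t0).
- apply/measurableT_comp => //; apply/measurable_EFinP; exact: measurable_indic.
Qed.

Let integrable_rest :
  mu.-integrable setT (EFin \o ((fun t => a t * phi t) \_ Rpos)).
Proof.
rewrite -restrict_EFin; apply/integrable_restrict => //; by rewrite setTI.
Qed.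

Let integrableF : ((mu \x mu)%E).-integrable setT F.
Proof.
apply/(integrable12ltyP mu mu mF).
under eq_integral do rewrite int_inner_abs.
by have /integrableP[] := integrable_rest.
Qed.

Hypothesis iaT : forall X : R, mu.-integrable `]0, X] (EFin \o a).

Let B v := Rintegral mu `]0, T v] a.

Let int_outer (v : R) : (\int[mu]_t F (t, v) = ((B \_ `]0, 1[) v)%:E)%E.
Proof.
case: (pselect (0 < v < 1)) => v01; last first.
  rewrite patchE memNset; last by rewrite /= in_itv.
  rewrite -[RHS](integral0 mu setT); apply: eq_integral => t _.
  rewrite /F indicE; case: (pselect (0 < (t : R))) => t0; last by rewrite aP0 ?mul0r.
  rewrite (_ : (t, v) \in D = false) ?mulr0//.
  apply/negP; rewrite inE /D/= => /andP[v0 vp]; apply: v01.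
  by rewrite v0 (le_lt_trans vp)//; case/andP: (phi01 t0).
rewrite patchE mem_set; last by rewrite /= in_itv.
transitivity (\int[mu]_t (((EFin \o a) \_ `]0%R, T v]) t))%E.
  apply: eq_integral => t _.
  rewrite /F indicE; case: (pselect (0 < (t : R))) => t0; last first.
    rewrite aP0// mul0r patchE memNset// /= in_itv/=.
    by move=> /andP[] /t0.
  rewrite aPE//.
  have -> : ((t, v) \in D) = (t <= T v).
    rewrite -phiT//; case/andP: v01 => v0 _.
    by apply/idP/idP; rewrite inE /D/= v0.
  rewrite patchE; case: (boolP (t <= T v)) => h.
    by rewrite mulr1 mem_set//= in_itv/= t0.
  by rewrite mulr0 memNset//= in_itv/= => /andP[_]; apply/negP.
rewrite -integral_mkcond /B /Rintegral fineK//.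
by apply: (integrable_fin_num _ (iaT (T v))); exact: measurable_itv.
Qed.

Lemma measurable_layer : measurable_fun U01 B.
Proof.
have h := measurable_fubini_G integrableF.
have mI : measurable U01 by exact: measurable_itv.
have /measurable_EFinP h2 : measurable_fun setT (EFin \o (B \_ U01)).
  rewrite (_ : EFin \o _ = fubini_G mu F)//.
  by apply/funext => v; rewrite /fubini_G int_outer.
exact: (measurable_restrictT B mI).2 h2.
Qed.

(** The number phi t is the length of the set of v with 0 < v <= phi t; Fubini's
    theorem then turns the weighted integral into an average over v of the
    integrals truncated at T v. *)
Lemma layer_cake : Rintegral mu Rpos (fun t => a t * phi t) =
  Rintegral mu U01 B.
Proof.
have h := Fubini integrableF.
rewrite Rintegral_mkcond [RHS]Rintegral_mkcond /Rintegral; congr fine.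
transitivity (\int[mu]_x \int[mu]_y F (x, y))%E.
  by apply: eq_integral => t _; rewrite int_inner.
rewrite h; apply: eq_integral => v _.
by rewrite int_outer.
Qed.

End LayerCake.

Section Abel.
Context {R : realType}.
Local Notation mu := (@lebesgue_measure R).
Local Notation Rpos := (`]0, +oo[%classic : set R).
Local Notation U01 := (`]0, 1[%classic : set R).

(** By [layer_cake] the weighted integrals are averages over v of truncated
    integrals. These are bounded and, for each v, the truncation level tends to
    infinity, so that dominated convergence applies even when a itself is only
    conditionally integrable. *)
Lemma abel (a : R -> R) (phi T : nat -> R -> R) (l : R) :
  (forall X : R, mu.-integrable `]0, X] (EFin \o a)) ->
  measurable_fun Rpos a ->
  (Rintegral mu `]0, X] a @[X --> +oo%R] --> l) ->
  (forall n, measurable_fun [set: R] (phi n)) ->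
  (forall n (t : R), 0 < t -> 0 < phi n t < 1) ->
  (forall n (t v : R), 0 < t -> 0 < v < 1 -> (v <= phi n t) = (t <= T n v)) ->
  (forall v : R, 0 < v < 1 -> T n v @[n --> \oo] --> +oo%R) ->
  (forall n, mu.-integrable Rpos (EFin \o (fun t => a t * phi n t))) ->
  Rintegral mu Rpos (fun t => a t * phi n t) @[n --> \oo] --> l.
Proof.
move=> ia ma al mphi phi01 phiT Too iaphi.
pose B X := Rintegral mu `]0, X] a.
have mI : measurable U01 by exact: measurable_itv.
have mU : mu U01 = 1%:E.
  by rewrite lebesgue_measure_itv/= lte_fin ltr01 sube0.
have iI (c : R) : mu.-integrable U01 (EFin \o cst c).
  apply/integrableP; split; first exact/measurable_EFinP.
  under eq_integral do rewrite /=.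
  by rewrite (integral_cst mu mI `|c|%:E) [X in (_ * X)%E](_ : _ = 1%:E)// mule1 ltry.
(* The truncated integrals are bounded by convergence beyond X0, and below X0 by
   the integral of the absolute value. *)
have [X0 hX0] : exists X0 : R, forall X, X0 < X -> `|l - B X| <= 1.
  by move/cvgrPdist_le : al => /(_ 1 ltr01) [X0 [_ h]]; exists X0.
pose N X := Rintegral mu `]0, X] (fun t => `|a t|).
have N0 X : 0 <= N X by apply: Rintegral_ge0 => t _; exact: normr_ge0.
have BN X : `|B X| <= N X.
  by apply: (le_normr_Rintegral _ (ia X)); exact: measurable_itv.
have NN X Y : X <= Y -> N X <= N Y.
  move=> XY; have iX := integrable_norm (ia X); have iY := integrable_norm (ia Y).
  rewrite -lee_fin /N /Rintegral !fineK; last 2 first.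
  - by apply: (integrable_fin_num _ iY); exact: measurable_itv.
  - by apply: (integrable_fin_num _ iX); exact: measurable_itv.
  apply: ge0_subset_integral => //.
  - by have /integrableP[] := iY.
  - by move=> t; rewrite /= !in_itv/= => /andP[-> /le_trans]; exact.
have HM X : `|B X| <= `|l| + 1 + N X0.
  case: (ltP X0 X) => hX.
    have := hX0 X hX; have := N0 X0.
    have : `|B X| <= `|l| + `|l - B X|.
      have e : B X = l - (l - B X) by ring.
      by rewrite {1}e ler_normB.
    by lra.
  by have := le_trans (BN X) (NN _ _ hX); have := normr_ge0 l; lra.
set M : R := `|l| + 1 + N X0 in HM.
have -> : l = Rintegral mu U01 (cst l).
  by rewrite Rintegral_cst// [X in fine X](_ : _ = 1%:E)// mulr1.
rewrite (_ : (fun n => _) = (fun n => Rintegral mu U01 (fun v => B (T n v)))); last first.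
  by apply/funext => n; exact: (layer_cake (iaphi n) ma (mphi n) (phi01 n) (phiT n) ia).
apply: (Rintegral_dct (u := fun n v => B (T n v)) (g := cst M) mI _ _ (iI M) _).2.
- move=> n; exact: (measurable_layer (iaphi n) ma (mphi n) (phi01 n) (phiT n) ia).
- move=> v; rewrite /= in_itv/= => v01.
  exact: (cvg_comp _ _ (Too v v01) al).
- by move=> n v _; exact: HM.
Qed.

End Abel.

(** * The regularising factor *)
Section Regulariser.
Context {R : realType}.
Local Notation mu := (@lebesgue_measure R).
Local Notation Rpos := (`]0, +oo[%classic : set R).

Definition reg (eps kap t : R) : R := expR (- (eps * expR (kap * ln t))).

(** The point t at which [reg] takes the value v. *)
Definition reg_level (eps kap v : R) : R := expR (ln (- ln v / eps) / kap).

(** One factor kap leaves room for path parameters slightly outside [0, 1], the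
    other one is the exponent of the regularising factor. *)
Lemma exponent_exists (phi : R) : `|phi| < pi / 2 ->
  exists2 kap : R, 1 < kap & kap * kap * `|phi| < pi / 2.
Proof.
have h0 : 0 < pi / 2 :> R by rewrite divr_gt0// pi_gt0.
set h := pi / 2 in h0 *; set f := `|phi| => fh.
have f0 : 0 <= f by exact: normr_ge0.
(* Then (1 + d)^2 f <= f + 3 d h < h, since d < 1 and f <= h. *)
pose d := (h - f) / (4 * h).
have h4 : 0 < 4 * h by rewrite mulr_gt0.
have d0 : 0 < d by rewrite divr_gt0// subr_gt0.
have dh : d * h = (h - f) / 4 by rewrite /d; field; rewrite gt_eqF.
have d1 : d < 1.
  by rewrite /d ltr_pdivrMr// mul1r; lra.
exists (1 + d); first by rewrite ltrDl.
have df : d * f <= d * h by rewrite ler_wpM2l// ltW.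
have ddf := ler_piMl (mulr_ge0 (ltW d0) f0) (ltW d1).
have -> : (1 + d) * (1 + d) * f = f + 2 * (d * f) + d * (d * f) by ring.
by lra.
Qed.

Variables (eps kap : R).
Hypothesis eps0 : 0 < eps.
Hypothesis kap1 : 1 < kap.

Lemma measurable_reg : measurable_fun [set: R] (reg eps kap).
Proof.
have h1 : measurable_fun [set: R] (fun t : R => kap * ln t).
  by apply: measurable_funM => //; exact: measurable_ln.
have h2 : measurable_fun [set: R] (fun t : R => expR (kap * ln t)).
  exact: (measurableT_comp (@measurable_expR R) h1).
have h3 : measurable_fun [set: R] (fun t : R => - eps * expR (kap * ln t)).
  exact: measurable_funM.
have -> : reg eps kap = (fun t => expR (- eps * expR (kap * ln t))).
  by apply/funext => t; rewrite /reg mulNr.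
exact: (measurableT_comp (@measurable_expR R) h3).
Qed.

Lemma reg01 (t : R) : 0 < reg eps kap t < 1.
Proof.
by rewrite expR_gt0/= expR_lt1 oppr_lt0 mulr_gt0 ?expR_gt0.
Qed.

Lemma reg_levelE (t v : R) : 0 < t -> 0 < v < 1 ->
  (v <= reg eps kap t) = (t <= reg_level eps kap v).
Proof.
move=> t0 /andP[v0 v1]; have k0 : 0 < kap by have := kap1; lra.
have lv : 0 < - ln v by rewrite oppr_gt0 ln_lt0// v0.
have q0 : 0 < - ln v / eps by rewrite divr_gt0.
rewrite -[X in (X <= _) = _]lnK ?posrE// /reg ler_expR lerNr.
rewrite mulrC -ler_pdivlMr// -[X in _ <= X]lnK ?posrE// ler_expR.
by rewrite -[X in _ = (X <= _)]lnK ?posrE// /reg_level ler_expR ler_pdivlMr// mulrC.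
Qed.

(** The power t^kap is superlinear, so [reg] decays faster than any exponential. *)
Lemma reg_dominates (q r : R) : 0 <= r ->
  exists C : R, forall t, 0 < t ->
    expR (- (r * t)) * reg eps kap t <= C * expR (- (q * t)).
Proof.
move=> r0; have k0 : 0 < kap - 1 by have := kap1; lra.
pose Q := `|q| + 1; have Q0 : 0 < Q by rewrite ltr_wpDl.
(* eps T0^(kap - 1) = Q, so that eps t^kap >= Q t for t >= T0. *)
pose T0 := expR (ln (Q / eps) / (kap - 1)).
exists (expR (Q * T0)) => t t0.
rewrite /reg -!expRD ler_expR.
have qQ : q * t <= Q * t by rewrite ler_wpM2r ?ltW// /Q; have := ler_norm q; lra.
have rt : 0 <= r * t by rewrite mulr_ge0// ltW.
have e0 : 0 <= eps * expR (kap * ln t) by rewrite mulr_ge0 ?expR_ge0// ltW.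
case: (leP t T0) => tT.
  have : Q * t <= Q * T0 by rewrite ler_wpM2l// ltW.
  by lra.
have QT : 0 <= Q * T0 by rewrite mulr_ge0 ?expR_ge0// ltW.
have : Q * t <= eps * expR (kap * ln t).
  have -> : kap * ln t = (kap - 1) * ln t + ln t by ring.
  rewrite expRD lnK ?posrE// mulrA ler_wpM2r ?(ltW t0)//.
  have Qe : 0 < Q / eps by rewrite divr_gt0.
  rewrite [leRHS]mulrC -ler_pdivrMr// -[X in X <= _]lnK ?posrE// ler_expR.
  rewrite [leRHS]mulrC -ler_pdivrMr// -[X in X <= _]expRK.
  by rewrite ler_ln ?posrE ?expR_gt0// ltW.
by lra.
Qed.

End Regulariser.

Section RegulariserLimit.
Context {R : realType}.

Definition reg_rate (n : nat) : R := n.+1%:R^-1.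

Lemma reg_rate_gt0 n : 0 < reg_rate n.
Proof. by rewrite invr_gt0. Qed.

Lemma reg_rate_cvg : reg_rate n @[n --> \oo] --> (0 : R).
Proof. exact: cvg_harmonic. Qed.

Lemma reg_level_cvg (kap v : R) : 1 < kap -> 0 < v < 1 ->
  reg_level (reg_rate n) kap v @[n --> \oo] --> +oo%R.
Proof.
move=> kap1 /andP[v0 v1]; have k0 : 0 < kap by lra.
have lv : 0 < - ln v by rewrite oppr_gt0 ln_lt0// v0.
apply/cvgryPge => A.
pose A' := `|A| + 1; have A0 : 0 < A' by rewrite ltr_wpDl.
near=> n; apply: (@le_trans _ _ A'); first by rewrite /A'; have := ler_norm A; lra.
rewrite -[X in X <= _]lnK ?posrE// /reg_level ler_expR ler_pdivlMr//.
rewrite -[X in X <= _]expRK ler_ln ?posrE ?expR_gt0//; last first.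
  by rewrite divr_gt0 ?reg_rate_gt0.
rewrite /reg_rate invrK [leRHS]mulrC -ler_pdivrMr//.
near: n; exists (Num.truncn (expR (ln A' * kap) / - ln v)) => // n /= hn.
by rewrite ltW// (lt_le_trans (truncnS_gt _))// ler_nat ltnS.
Unshelve. all: by end_near. Qed.

End RegulariserLimit.

Section SeriesIntegrable.
Context {R : realType}.
Local Notation mu := (@lebesgue_measure R).
Local Notation Rpos := (`]0, +oo[%classic : set R).

Lemma integrable_nonneg_series (h : nat -> R -> R) :
  (forall k t, 0 <= h k t) ->
  (forall k, mu.-integrable Rpos (EFin \o h k)) ->
  (forall t : R, 0 < t -> cvgn (series (fun k => h k t))) ->
  cvgn (series (fun k => Rintegral mu Rpos (h k))) ->
  mu.-integrable Rpos (EFin \o (fun t => limn (series (fun k => h k t)))).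
Proof.
move=> h0 ih ch cI.
have mh k : measurable_fun Rpos (EFin \o h k) by have /integrableP[] := ih k.
have limE (t : R) : 0 < t ->
    (limn (series (fun k => h k t)))%:E = (\sum_(0 <= k <oo) (h k t)%:E)%E.
  move=> t0; apply/esym/cvg_lim => //.
  rewrite (_ : (fun n => _) = EFin \o series (fun k => h k t)); last first.
    by apply/funext => n; rewrite /= sumEFin.
  by apply: cvg_EFin; [exact: nearW|exact: ch].
apply/integrableP; split.
  apply: (emeasurable_fun_cvg (fun n t => \sum_(0 <= k < n) (h k t)%:E)%E).
    by move=> n; exact: emeasurable_sum.
  move=> t /RposP t0; rewrite (_ : (fun n => _) = EFin \o series (fun k => h k t)).
    by apply: cvg_EFin; [exact: nearW|exact: ch].
  by apply/funext => n; rewrite /= sumEFin.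
have -> : (\int[mu]_(x in Rpos)
      `|(EFin \o (fun t => limn (series (fun k => h k t)))) x| =
    \int[mu]_(x in Rpos) (\sum_(0 <= k <oo) (h k x)%:E))%E.
  apply: eq_integral => t; rewrite inE => /RposP t0; rewrite /= -limE// ger0_norm//.
  by apply: limr_ge; [exact: ch|apply: nearW => n; exact: sumr_ge0].
rewrite integral_nneseries//; last by move=> k t _; rewrite lee_fin.
rewrite (_ : (\sum_(0 <= k <oo) _)%E = (limn (series (fun k => Rintegral mu Rpos (h k))))%:E) ?ltry//.
apply/cvg_lim => //.
rewrite (_ : (fun n => _) = EFin \o series (fun k => Rintegral mu Rpos (h k))).
  by apply: cvg_EFin; [exact: nearW|exact: cI].
apply/funext => n; rewrite /= /series/= -sumEFin; apply: eq_bigr => k _.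
rewrite /Rintegral fineK//.
by apply: (integrable_fin_num _ (ih k)); exact: measurable_Rpos.
Qed.

End SeriesIntegrable.

(** * Termwise Laplace transform of a generalised power series *)
Section Core.
Context {R : realType}.
Local Notation mu := (@lebesgue_measure R).
Local Notation Rpos := (`]0, +oo[%classic : set R).

Variables (rho p : R[i]) (e : nat -> R[i]) (s : nat -> R) (f : R -> R[i]).
Hypothesis hrho : 0 < complex.Re rho.
Hypothesis hp : 0 < complex.Re p.
Hypothesis s0 : forall k, 0 <= s k.
Local Notation L := (clog p).
Local Notation z k := (rho + (s k)%:C).
Local Notation sg k := (complex.Re rho + s k).

Hypothesis f_series : forall t : R, 0 < t ->
  ccvg (fun N => \sum_(k < N) e k * (expR (s k * ln t))%:C) (f t).
Hypothesis f_abs : forall t : R, 0 < t ->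
  cvgn (series (fun k => cmod (e k) * expR (s k * ln t))).
Hypothesis D_abs :
  cvgn (series (fun k => cmod (e k * (cexp (- z k * L) * Gamma (z k))))).

Lemma Re_zk k : complex.Re (z k) = sg k.
Proof. by rewrite cReD. Qed.

Lemma zk_gt0 k : 0 < complex.Re (z k).
Proof. by rewrite Re_zk; have := hrho; have := s0 k; lra. Qed.

(** Integrals of absolute values involve Gamma (Re z), the hypothesis only
    |Gamma z|: [Gamma_lower] makes them comparable along the z k, which have the
    same imaginary part. *)
Lemma real_abs_summable :
  cvgn (series (fun k => cmod (e k) * (cmod (cexp (- z k * L)) * rGamma (sg k)))).
Proof.
have [c c0 hc] := Gamma_lower (complex.Im rho) hrho.
apply: (cvgn_series_le _ _ (cvgn_seriesZ c^-1 D_abs)) => k.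
  by rewrite !mulr_ge0 ?cmod_ge0 ?rGamma_ge0.
rewrite cmodM [cmod (cexp _ * _)]cmodM.
have hs : complex.Re rho <= sg k by rewrite lerDl.
have := hc _ hs.
have -> : sg k +i* complex.Im rho = z k.
  by apply: complex_ext; rewrite ?cReD ?cImD /= ?addr0.
move=> h; rewrite -(ler_pM2l c0) mulVKf ?gt_eqF//.
rewrite mulrCA ler_wpM2l ?cmod_ge0// mulrCA ler_wpM2l ?cmod_ge0//.
Qed.

Definition laplace_integrand (t : R) : R[i] :=
  laplace_kernel (fun t => cpow t%:C (rho - 1) * f t) p t.

Lemma tkernE (eps kap t : R) k : 0 < t ->
  tkern (z k) p eps kap t =
  (cexp ((rho - 1) * (ln t)%:C) * cexp (- (p * t%:C)) * (reg eps kap t)%:C) *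
  (expR (s k * ln t))%:C.
Proof.
move=> t0; rewrite /tkern /reg -2!cexp_real -!cexpD; congr cexp.
by rewrite rmorphM/=; ring.
Qed.

Lemma cexp_zk k : expR (- sg k * ln (cmod p)) =
  expR (- (complex.Im rho * carg p)) * cmod (cexp (- z k * L)).
Proof.
rewrite cmod_cexp -expRD; congr expR.
by rewrite cReM cReN cImN cReD cImD /=; ring.
Qed.

(** By [reg_dominates] the partial sums are bounded by a constant times the series
    of the |e k| t^(sg k - 1) exp (- |p| t), which is integrable by
    [real_abs_summable]. *)
Lemma regularised_swap (eps kap : R) : 0 < eps -> 1 < kap ->
  kap * kap * `|carg p| < pi / 2 ->
  cintegrable Rpos (fun t => laplace_integrand t * (reg eps kap t)%:C) /\
  ccvg (fun N => \sum_(k < N) e k * cintegral Rpos (tkern (z k) p eps kap))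
    (cintegral Rpos (fun t => laplace_integrand t * (reg eps kap t)%:C)).
Proof.
move=> e0 k1 kp; have mR := measurable_Rpos (R := R).
have it k : cintegrable Rpos (tkern (z k) p eps kap).
  by apply: cintegrable_tkern => //; [exact: zk_gt0|exact: ltW].
have itZ k : cintegrable Rpos (fun t => e k * tkern (z k) p eps kap t).
  exact: cintegrableZ.
have [C hC] := reg_dominates e0 k1 (cmod p) (ltW hp).
have C0 : 0 <= C.
  have := hC 1 ltr01; rewrite -ler_pdivrMr ?expR_gt0//; apply: le_trans.
  by rewrite divr_ge0 ?mulr_ge0 ?expR_ge0.
have p0 := right_cmod_gt0 hp.
(* The majorant of the k-th term. *)
pose h k t : R := cmod (e k) * C * gdens (sg k) (cmod p) t.
have h0 k t : 0 <= h k t by rewrite !mulr_ge0 ?cmod_ge0 ?gdens_ge0.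
have sgk k : 0 < sg k by rewrite -Re_zk zk_gt0.
have ih k : mu.-integrable Rpos (EFin \o h k) by exact: integrableZ_gdens.
have tb k t : 0 < t -> cmod (e k * tkern (z k) p eps kap t) <= h k t.
  move=> t0; rewrite cmodM /h -mulrA ler_wpM2l ?cmod_ge0// /tkern cmodM cmod_real cmod_cexp.
  rewrite ger0_norm ?expR_ge0// -/(reg eps kap t).
  have -> : complex.Re ((z k - 1) * (ln t)%:C - p * t%:C) =
      (sg k - 1) * ln t + (- (complex.Re p * t)).
    by rewrite cReD cReN !cReM !cReD !cReN /=; ring.
  rewrite expRD -mulrA /gdens expRD [leRHS]mulrCA ler_wpM2l ?expR_ge0//.
  exact: hC.
have ch t : 0 < t -> cvgn (series (fun k => h k t)).
  move=> t0.
  rewrite (_ : (fun k => h k t) = (fun k => C * gdens (complex.Re rho) (cmod p) t *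
    (cmod (e k) * expR (s k * ln t)))); first exact: cvgn_seriesZ (f_abs t0).
  by apply/funext => k; rewrite /h -(gdens_mul (s k)); ring.
have cI : cvgn (series (fun k => Rintegral mu Rpos (h k))).
  rewrite (_ : (fun k => _) = (fun k => C * expR (- (complex.Im rho * carg p)) *
    (cmod (e k) * (cmod (cexp (- z k * L)) * rGamma (sg k))))).
    exact: cvgn_seriesZ real_abs_summable.
  apply/funext => k; have ig := integrable_gdens (sgk k) p0.
  by rewrite /h RintegralZl// rGamma_scale// cexp_zk; ring.
have ig := integrable_nonneg_series h0 ih ch cI.
pose u N t : R[i] := \sum_(k < N) e k * tkern (z k) p eps kap t.
have ucvg t : Rpos t -> ccvg (u ^~ t) (laplace_integrand t * (reg eps kap t)%:C).
  move=> /RposP t0.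
  pose w := cexp ((rho - 1) * (ln t)%:C) * cexp (- (p * t%:C)) * (reg eps kap t)%:C.
  have -> : laplace_integrand t * (reg eps kap t)%:C = w * f t.
    by rewrite /laplace_integrand /laplace_kernel cpow_pos// /w; ring.
  rewrite (_ : u ^~ t = (fun N => w * \sum_(k < N) e k * (expR (s k * ln t))%:C)).
    exact/ccvgZ/f_series.
  apply/funext => N; rewrite /u mulr_sumr; apply: eq_bigr => k _.
  by rewrite tkernE// -/w mulrCA.
have ub N t : Rpos t -> cmod (u N t) <= limn (series (fun k => h k t)).
  move=> /RposP t0.
  apply: (le_trans (cmod_sum N (fun k => e k * tkern (z k) p eps kap t))).
  apply: (@le_trans _ _ (series (fun k => h k t) N)).
    by rewrite /series/= big_mkord; apply: ler_sum => k _; exact: tb.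
  apply: nondecreasing_cvgn_le; last exact: ch.
  by apply: nondecreasing_series => k _ _; exact: h0.
have mu_ N : cmeasurable Rpos (u N).
  exact: cintegrable_cmeasurable (cintegrable_sum N mR itZ).
have [iF cF] := cintegral_dct mR mu_ ucvg ig ub.
split => //.
rewrite (_ : (fun N => _) = (fun N => cintegral Rpos (u N)))//.
apply/funext => N; rewrite /u (cintegral_sum N mR itZ); apply: eq_bigr => k _.
by rewrite cintegralZ.
Qed.

(** As eps tends to 0, the regularised integral tends to the Laplace transform by
    [abel] and to V by [regularised_swap] and [ctannery]. *)
Lemma laplace_series (V : R[i]) :
  laplace_exists (fun t => cpow t%:C (rho - 1) * f t) p ->
  ccvg (fun N => \sum_(k < N) e k * (cexp (- z k * L) * Gamma (z k))) V ->
  laplace (fun t => cpow t%:C (rho - 1) * f t) p = V.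
Proof.
move=> [iT cRe cIm] DV.
have [kap k1 kp] := exponent_exists (norm_carg_lt hp).
pose U n := cintegral Rpos (fun t => laplace_integrand t * (reg (reg_rate n) kap t)%:C).
have sw n := regularised_swap (reg_rate_gt0 n) k1 kp.
have UV : ccvg U V.
  apply: (@ctannery _ (fun n k => e k * cintegral Rpos (tkern (z k) p (reg_rate n) kap))
    (fun k => e k * (cexp (- z k * L) * Gamma (z k))) U V
    (fun k => 2 * (cmod (e k) * (cmod (cexp (- z k * L)) * rGamma (sg k))))).
  - move=> n k; rewrite cmodM mulrCA ler_wpM2l ?cmod_ge0// -Re_zk.
    by apply: cintegral_tkern_bound => //; [exact: zk_gt0|exact/ltW/reg_rate_gt0].
  - move=> k; apply: ccvgZ; apply: cintegral_tkern_cvg => //.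
    + exact: zk_gt0.
    + by move=> n; exact/ltW/reg_rate_gt0.
    + exact: reg_rate_cvg.
  - exact: cvgn_seriesZ real_abs_summable.
  - by move=> n; have [] := sw n.
  - exact: DV.
apply: (ccvg_unique _ UV).
have ia X : cintegrable `]0, X] laplace_integrand.
  case: (ltP 0 X) => X0; first exact: iT.
  by rewrite set_itv_ge -?leNgt//; split; exact: integrable_set0.
have mL : cmeasurable Rpos laplace_integrand.
  have sub n : exhaust n `<=` (`]0, n.+2%:R]%classic : set R).
    move=> t tn; have t0 := RposP (exhaust_sub tn).
    by move: tn; rewrite /exhaust /= !in_itv/= t0 => /andP[].
  have mn n : measurable (`]0, n.+2%:R]%classic : set R) by exact: measurable_itv.
  split; rewrite -bigcup_exhaust; apply/measurable_fun_bigcup => n;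
    try exact: measurable_itv.
  - by apply: (measurable_funS (mn n) (@sub n)); have [] := cintegrable_cmeasurable (ia n.+2%:R).
  - by apply: (measurable_funS (mn n) (@sub n)); have [] := cintegrable_cmeasurable (ia n.+2%:R).
have E n : U n = Rintegral mu Rpos (fun t => complex.Re (laplace_integrand t) * reg (reg_rate n) kap t)
    +i* Rintegral mu Rpos (fun t => complex.Im (laplace_integrand t) * reg (reg_rate n) kap t).
  by rewrite /U /cintegral; congr (_ +i* _); apply: eq_Rintegral => t _;
    rewrite mulrC ?cRe_realM ?cIm_realM mulrC.
have ir n : cintegrable Rpos (fun t => laplace_integrand t * (reg (reg_rate n) kap t)%:C).
  by have [] := sw n.
rewrite /laplace; split => /=.
- rewrite (_ : (fun n => complex.Re (U n)) = (fun n => Rintegral mu Rpos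
    (fun t => complex.Re (laplace_integrand t) * reg (reg_rate n) kap t))); last first.
    by apply/funext => n; rewrite E.
  apply: (@abel _ (fun t => complex.Re (laplace_integrand t)) (fun n => reg (reg_rate n) kap)
     (fun n => reg_level (reg_rate n) kap)).
  + by move=> X; have [] := ia X.
  + exact: mL.1.
  + exact: cRe.
  + by move=> n; exact: measurable_reg.
  + by move=> n t _; apply: reg01; exact: reg_rate_gt0.
  + by move=> n t v t0 v01; apply: reg_levelE => //; exact: reg_rate_gt0.
  + by move=> v; exact: reg_level_cvg.
  + move=> n; have [h _] := ir n; apply: eq_integrable h => //.
    by move=> t _; rewrite /= mulrC cRe_realM mulrC.
- rewrite (_ : (fun n => complex.Im (U n)) = (fun n => Rintegral mu Rpos
    (fun t => complex.Im (laplace_integrand t) * reg (reg_rate n) kap t))); last first.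
    by apply/funext => n; rewrite E.
  apply: (@abel _ (fun t => complex.Im (laplace_integrand t)) (fun n => reg (reg_rate n) kap)
     (fun n => reg_level (reg_rate n) kap)).
  + by move=> X; have [] := ia X.
  + exact: mL.2.
  + exact: cIm.
  + by move=> n; exact: measurable_reg.
  + by move=> n t _; apply: reg01; exact: reg_rate_gt0.
  + by move=> n t v t0 v01; apply: reg_levelE => //; exact: reg_rate_gt0.
  + by move=> v; exact: reg_level_cvg.
  + move=> n; have [_ h] := ir n; apply: eq_integrable h => //.
    by move=> t _; rewrite /= mulrC cIm_realM mulrC.
Qed.

End Core.

(** * The terms of the two double series *)
Section Terms.
Context {R : realType}.
Implicit Types (t : R) (x y : R[i]).

Lemma powR_expn t (a : R) (m : nat) : 0 < t ->
  ((t `^ a) ^+ m)%R = expR (a * m%:R * ln t).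
Proof.
move=> t0; rewrite /powR gt_eqF// -expRM_natl; congr expR.
by rewrite mulrA [_ * a]mulrC.
Qed.

Lemma E1_term_scale (g1 : R[i]) (a1 : R) (g2 : R[i]) (b1 : R)
    (d1 : R[i]) (a2 b2 : R) (d2 : R[i]) (a3 : R) (d3 : R[i]) (b3 : R)
    x y (mu1 mu2 t : R) m n : 0 < t ->
  E1_term g1 a1 g2 b1 d1 a2 b2 d2 a3 d3 b3
    (x * (t `^ mu1)%:C) (y * (t `^ mu2)%:C) m n =
  E1_term g1 a1 g2 b1 d1 a2 b2 d2 a3 d3 b3 x y m n *
    (expR ((mu1 * m%:R + mu2 * n%:R) * ln t))%:C.
Proof.
move=> t0; rewrite /E1_term !exprMn -!rmorphXn/= !powR_expn//.
rewrite mulrDl expRD; set A := expR _; set B := expR _.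
by rewrite [(A * B)%:C]rmorphM/=; ring.
Qed.

Lemma poch_right (g : R[i]) (l : R) : 0 < complex.Re g ->
  poch g l = Gamma (g + l%:C) / Gamma g.
Proof.
move=> hg; rewrite /poch ifF//; apply/negbTE; rewrite negb_and.
apply/orP; left; apply/asboolPn => -[k gk].
move: hg; rewrite gk cReN -(rmorph_nat (real_complex R)) /= oppr_gt0.
by rewrite ltNge ler0n.
Qed.

(** The denominator Gamma rho of the Pochhammer symbol cancels, which uses that
    Gamma rho is nonzero. *)
Lemma D1_term_E1 (rho p : R[i]) (mu1 mu2 : R) (g1 : R[i]) (a1 : R) (g2 : R[i]) (b1 : R)
    (d1 : R[i]) (a2 b2 : R) (d2 : R[i]) (a3 : R) (d3 : R[i]) (b3 : R)
    x y m n : 0 < complex.Re rho -> 0 < complex.Re p ->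
  Gamma rho / cpow p rho *
    D1_term rho mu1 mu2 g1 a1 g2 b1 d1 a2 b2 d2 a3 d3 b3
      (x / cpow p mu1%:C) (y / cpow p mu2%:C) m n =
  E1_term g1 a1 g2 b1 d1 a2 b2 d2 a3 d3 b3 x y m n *
    (cexp (- (rho + (mu1 * m%:R + mu2 * n%:R)%:C) * clog p) *
     Gamma (rho + (mu1 * m%:R + mu2 * n%:R)%:C)).
Proof.
move=> hrho hp; have G0 := Gamma_neq0 hrho.
rewrite /D1_term /E1_term poch_right// !cpow_right//.
rewrite !exprMn -!cexpN -!cexp_nat.
set S := mu1 * _ + _.
have -> : cexp (- (rho + S%:C) * clog p) = cexp (- (rho * clog p)) *
    cexp (m%:R * - (mu1%:C * clog p)) * cexp (n%:R * - (mu2%:C * clog p)).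
  rewrite -!cexpD; congr cexp; rewrite /S rmorphD !rmorphM/= !rmorph_nat.
  by ring.
set i1 := (Gamma (d1 + _))^-1; set i2 := (Gamma (d2 + _))^-1.
by set i3 := (Gamma (d3 + _))^-1; field.
Qed.

End Terms.

Unset Implicit Arguments.
Set Strict Implicit.
Set Printing Implicit Defensive.

Theorem mainTheorem13 (R : realType)
    (g1 g2 d1 d2 d3 x y rho p : R[i])
    (a1 a2 a3 b1 b2 b3 mu1 mu2 : R)
    (hrho : 0 < complex.Re rho)
    (ha1 : 0 < a1) (ha2 : 0 < a2) (ha3 : 0 < a3)
    (hb1 : 0 < b1) (hb2 : 0 < b2) (hb3 : 0 < b3)
    (hmu1 : 0 < mu1) (hmu2 : 0 < mu2)
    (hp : 0 < complex.Re p)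
    (hE : forall t : R, 0 < t ->
      abs_summable2 (E1_term g1 a1 g2 b1 d1 a2 b2 d2 a3 d3 b3
        (x * (t `^ mu1)%:C) (y * (t `^ mu2)%:C)))
    (hD : abs_summable2 (D1_term rho mu1 mu2 g1 a1 g2 b1
        d1 a2 b2 d2 a3 d3 b3 (x / cpow p mu1%:C) (y / cpow p mu2%:C)))
    (hL : laplace_exists
      (fun t : R => cpow t%:C (rho - 1) *
        E1 g1 a1 g2 b1 d1 a2 b2 d2 a3 d3 b3
          (x * (t `^ mu1)%:C) (y * (t `^ mu2)%:C)) p) :
  laplace
    (fun t : R => cpow t%:C (rho - 1) *
      E1 g1 a1 g2 b1 d1 a2 b2 d2 a3 d3 b3
        (x * (t `^ mu1)%:C) (y * (t `^ mu2)%:C)) p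
  = Gamma rho / cpow p rho *
    D1 rho mu1 mu2 g1 a1 g2 b1 d1 a2 b2 d2 a3 d3 b3
      (x / cpow p mu1%:C) (y / cpow p mu2%:C).
Proof.
have [e he] := nat2_enum.
pose ek k := E1_term g1 a1 g2 b1 d1 a2 b2 d2 a3 d3 b3 x y (e k).1 (e k).2.
pose s k : R := mu1 * (e k).1%:R + mu2 * (e k).2%:R.
have s0 k : 0 <= s k by rewrite addr_ge0// mulr_ge0// ltW.
pose dk k := D1_term rho mu1 mu2 g1 a1 g2 b1 d1 a2 b2 d2 a3 d3 b3
  (x / cpow p mu1%:C) (y / cpow p mu2%:C) (e k).1 (e k).2.
have dE k : ek k * (cexp (- (rho + (s k)%:C) * clog p) * Gamma (rho + (s k)%:C)) =
    Gamma rho / cpow p rho * dk k by rewrite D1_term_E1.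
apply: (@laplace_series _ rho p ek s) => //.
- move=> t t0; have := csum2_enum he (hE t t0).
  rewrite (_ : (fun N => _) = (fun N => \sum_(k < N) ek k * (expR (s k * ln t))%:C))//.
  apply/funext => N; apply: eq_bigr => k _; exact: E1_term_scale.
- move=> t t0; have := abs_summable2_enum he (hE t t0).
  rewrite (_ : (fun k => _) = (fun k => cmod (ek k) * expR (s k * ln t)))//.
  apply/funext => k; rewrite E1_term_scale// cmodM cmod_real.
  by rewrite [X in _ * X]ger0_norm// expR_ge0.
- have := cvgn_seriesZ (cmod (Gamma rho / cpow p rho)) (abs_summable2_enum he hD).
  rewrite (_ : (fun k => _) = (fun k => cmod (ek k * (cexp (- (rho + (s k)%:C) * clog p) *
    Gamma (rho + (s k)%:C)))))//.
  by apply/funext => k; rewrite dE [RHS]cmodM.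
- have := ccvgZ (Gamma rho / cpow p rho) (csum2_enum he hD).
  rewrite (_ : (fun N => _) = (fun N => \sum_(k < N) ek k *
    (cexp (- (rho + (s k)%:C) * clog p) * Gamma (rho + (s k)%:C))))//.
  by apply/funext => N; rewrite mulr_sumr; apply: eq_bigr => k _; rewrite dE.
Qed.
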